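(* Let $m\ge1$ and let $(f_0,\dots,f_{m-1})$ be any carrier system of modulus $m$ for $xD$. Then for all $n\ge0$ $$(xD)^nf_0(x)=\sum_{k=0}^n\mathsf S_m(n,k)\,x^kf_{k\bmod m}(x),$$ and $$f_0(xe^t)=\sum_{n=0}^\infty\frac{t^n}{n!}\sum_{k=0}^n\mathsf S_m(n,k)\,x^kf_{k\bmod m}(x).$$ The first display is a finite algebraic identity, valid verbatim for formal power series. The second is an identity of formal power series in $t$ (with $f_0(xe^t)$ understood as $e^{txD}f_0(x)=\sum_{n\ge0}\frac{t^n}{n!}(xD)^nf_0(x)$); when $f_0$ is analytic on an open set containing $\{xe^s:|s|\le|t|\}$, it holds moreover as an equality of analytic functions. The carrier systems $(I_0,I_1)$ and $(K_0,-K_1)$ (both of modulus $2$) and the hyper-Bessel systems $(C^{(m)}_0,\dots,C^{(m)}_{m-1})$ consist of functions analytic on $(0,\infty)$, and for them the second expansion is valid for all $x>0$ and all real $t$.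
   Context: $D$ denotes $d/dx$. A carrier system of modulus $m$ for the operator $xD$ is a family $(f_0,\dots,f_{m-1})$ of differentiable functions on a common open subset of $(0,\infty)$ (or of formal power series) satisfying $$(xD+r)f_r=x\,f_{(r+1)\bmod m},\qquad r=0,1,\dots,m-1.$$ The $m$-Stirling numbers of the second kind $\mathsf S_m(n,k)$ are defined for integers $n,k\ge0$ by $\mathsf S_m(0,k)=\delta_{0,k}$, the convention $\mathsf S_m(n,k)=0$ for $k<0$, and the recurrence $\mathsf S_m(n+1,k)=m\lfloor k/m\rfloor\,\mathsf S_m(n,k)+\mathsf S_m(n,k-1)$. $I_\nu$ and $K_\nu$ are the modified Bessel functions of the first and second kind of order $\nu$. The hyper-Bessel system of modulus $m$ is given by $$C^{(m)}_0(x)=\sum_{k=0}^\infty\frac{(x/m)^{mk}}{(k!)^m},\qquad C^{(m)}_r(x)=\sum_{k=0}^\infty\frac{(x/m)^{mk+m-r}}{(k!)^r\,((k+1)!)^{m-r}}\quad(1\le r\le m-1).$$ *)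

(* Defs.v *)
From mathcomp Require all_boot all_algebra.
From Stdlib Require Import Reals Factorial PeanoNat.
From Coquelicot Require Import Coquelicot.

Open Scope R_scope.

(* Since [0 / m = 0], the term S_m(n, -1) = 0 needed at [k = 0] is dropped. *)
Fixpoint mStirling2 (m n k : nat) : nat :=
  match n with
  | O => match k with O => 1 | S _ => 0 end
  | S n' =>
      m * (k / m) * mStirling2 m n' k
      + match k with O => 0 | S k' => mStirling2 m n' k' end
  end%nat.

(* Functions of a real variable are complex-valued throughout; real-valued
   functions are embedded through [RtoC].  [CDerive f x] is the derivative of
   [f] at [x] whenever [differentiable f x]; otherwise it is a junk value. *)
Definition CDerive (f : R -> C) (x : R) : C :=
  (Derive (fun y => Re (f y)) x, Derive (fun y => Im (f y)) x).

Definition differentiable (f : R -> C) (x : R) : Prop :=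
  @ex_derive R_AbsRing C_R_NormedModule f x.

Definition xD (f : R -> C) (x : R) : C := (RtoC x * CDerive f x)%C.

Definition carrier_system (m : nat) (U : R -> Prop) (f : nat -> R -> C) : Prop :=
  open U /\
  (forall x, U x -> 0 < x) /\
  (forall r, (r < m)%nat -> forall x, U x ->
     differentiable (f r) x /\
     (xD (f r) x + RtoC (INR r) * f r x
      = RtoC x * f (Nat.modulo (r + 1) m) x)%C).

Definition stirling_sum (m : nat) (f : nat -> R -> C) (n : nat) (x : R) : C :=
  sum_n (fun k => (RtoC (INR (mStirling2 m n k)) * RtoC (x ^ k)
                   * f (Nat.modulo k m) x)%C) n.

(* Formal power series in t are given by their sequences of coefficients. *)
Definition exp_txD (f : R -> C) (x : R) (n : nat) : C :=
  (RtoC (/ INR (fact n)) * Nat.iter n xD f x)%C.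

Definition stirling_series (m : nat) (f : nat -> R -> C) (x : R) (n : nat) : C :=
  (RtoC (/ INR (fact n)) * stirling_sum m f n x)%C.

(* Sum of the power series with coefficients [a] at the complex number [z]. *)
Definition is_Cpseries (a : nat -> C) (z l : C) : Prop :=
  @is_pseries C_AbsRing C_NormedModule a z l.

Definition analytic_at (f : R -> C) (x : R) : Prop :=
  exists (a : nat -> C) (rho : R), 0 < rho /\
    forall y : R, Rabs (y - x) < rho -> is_Cpseries a (RtoC (y - x)) (f y).

Definition Canalytic_at (g : C -> C) (z : C) : Prop :=
  exists (a : nat -> C) (rho : R), 0 < rho /\
    forall w : C, Cmod (w - z)%C < rho -> is_Cpseries a (w - z)%C (g w).

Definition Cexp (z : C) : C :=
  (exp (Re z) * cos (Im z), exp (Re z) * sin (Im z)).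

(* Modified Bessel functions of integer order n. *)
Definition besselI (n : nat) (x : R) : R :=
  Series (fun k => (x / 2) ^ (2 * k + n) / (INR (fact k) * INR (fact (k + n)))).

(* Integral representation of K_n, for x > 0:
   the integral over [0, +oo) of exp(-x cosh t) cosh(n t) dt. *)
Definition besselK (n : nat) (x : R) : R :=
  RInt_gen (fun t => exp (- x * cosh t) * cosh (INR n * t))
           (at_point 0) (Rbar_locally p_infty).

Definition hyperBessel (m r : nat) (x : R) : R :=
  match r with
  | O => Series (fun k => (x / INR m) ^ (m * k) / INR (fact k) ^ m)
  | S _ => Series (fun k =>
      (x / INR m) ^ (m * k + m - r)
      / (INR (fact k) ^ r * INR (fact (k + 1)) ^ (m - r)))
  end.

Definition besselI_system (r : nat) (x : R) : C :=
  RtoC (match r with O => besselI 0 x | S _ => besselI 1 x end).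

Definition besselK_system (r : nat) (x : R) : C :=
  RtoC (match r with O => besselK 0 x | S _ => - besselK 1 x end).

Definition hyperBessel_system (m r : nat) (x : R) : C :=
  RtoC (hyperBessel m r x).

Inductive bessel_type : nat -> (nat -> R -> C) -> Prop :=
  | bessel_type_I : bessel_type 2 besselI_system
  | bessel_type_K : bessel_type 2 besselK_system
  | bessel_type_hyper (m : nat) :
      (1 <= m)%nat -> bessel_type m (hyperBessel_system m).

(* Formal power series in x over K are given by their coefficient sequences
   [a : nat -> K]. *)
Module FPS.
Import all_boot all_algebra GRing.Theory.
Local Open Scope ring_scope.

(* x^k a *)
Definition mulXn {K : nzRingType} (k : nat) (a : nat -> K) (j : nat) : K :=
  if (j < k)%N then 0 else a (j - k)%N.

Definition D {K : nzRingType} (a : nat -> K) (j : nat) : K := a j.+1 *+ j.+1.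

Definition xD {K : nzRingType} (a : nat -> K) : nat -> K := mulXn 1 (D a).

Definition carrier_system {K : nzRingType} (m : nat) (a : nat -> nat -> K) : Prop :=
  forall r : nat, (r < m)%N -> forall j : nat,
    xD (a r) j + a r j *+ r = mulXn 1 (a (Nat.modulo (r + 1) m)) j.

Definition stirling_sum {K : nzRingType} (m : nat) (a : nat -> nat -> K)
    (n j : nat) : K :=
  \sum_(0 <= k < n.+1) mulXn k (a (Nat.modulo k m)) j *+ mStirling2 m n k.

(* Formal power series in t with coefficients in K[[x]]: the coefficient of
   t^n x^j is the value at [n j]. *)
Definition exp_txD {K : fieldType} (a : nat -> K) (n j : nat) : K :=
  (n`!%:R)^-1 * Nat.iter n xD a j.

Definition stirling_series {K : fieldType} (m : nat) (a : nat -> nat -> K)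
    (n j : nat) : K :=
  (n`!%:R)^-1 * stirling_sum m a n j.

Definition char_zero (K : fieldType) : Prop := [pchar K] =i pred0.

End FPS.

(* Main.v *)
Require Import Defs.
From mathcomp Require Import ssreflect ssralg.
From Stdlib Require Import Reals Factorial PeanoNat Lra Lia Classical.
From Coquelicot Require Import Coquelicot.

Open Scope R_scope.

(** Put F_k(x) = x^k f_{k mod m}(x).  The carrier equations say exactly that
    xD F_k = m (k / m) F_k + F_{k+1}, with k / m the integer quotient: the
    operator xD climbs a ladder whose rung k has rate m (k / m).  Iterating
    from F_0 = f_0 produces the coefficients defined by the recurrence of
    S_m(n,k), which is the finite identity.  The same computation, done on
    coefficients, proves it for formal power series
    ([iter_xD_stirling_sum], [FormalSeries.iter_xD_stirling_sum]).

    The analytic statements rest on Taylor's formula with remainder along the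
    curve tau |-> x e^(tau s), 0 <= tau <= 1: there d/dtau is s times xD, so
    the n-th derivative of f_0 is s^n times a Stirling sum.  The carrier
    functions are bounded on the curve, and k! S_m(n,k) <= (2k)^n makes the
    Stirling sums O(n! r^-n) for every r > 0.  Hence the remainder vanishes
    whatever s is, real or complex ([stirling_taylor]).  For a system
    on (0, oo) this is the expansion for all t ([stirling_expansion]).

    For an arbitrary system only the values near x are tied to the equations.
    They give (xD)^m f_0 = x^m f_0 near x.  If f_0, or an analytic extension g
    of it, is given by local power series along the whole curve, then so is
    (xD)^m g - x^m g, and it vanishes near x; by the identity theorem it
    vanishes on the curve ([germ_propagation]).  Therefore the functions
    x^r f_r := (xD)^r g, r < m, continue the ladder along the curve and the
    Taylor argument applies again ([carrier_continuation]).  The real and the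
    complex versions differ only in where the local power series come from.

    Each member of a carrier system is analytic, because the ladder for D in
    place of xD bounds its n-th derivative by K n! A^n ([carrier_analytic]).
    So for the Bessel systems it remains to check the carrier equations:
    termwise for the hyper-Bessel series, of which (I_0, I_1) is the case
    m = 2, and for (K_0, -K_1) by differentiating under the integral sign and
    one integration by parts ([hyperBessel_carrier], [besselK_carrier]). *)

(** Many types below are only convertible to C or R, which hides the ring
    structure from the ring tactic. *)
Ltac Cring := match goal with |- @eq _ ?a ?b => change (@eq C a b) end; ring.
Ltac Rring := match goal with |- @eq _ ?a ?b => change (@eq R a b) end; ring.

(** * Complex-valued functions of a real variable *)

(** Differentiation by components: products, powers and uniqueness reduce to
    the real case, while [differentiable] speaks of one vector-valued
    derivative. *)
Definition Cder (f : R -> C) (x : R) (l : C) : Prop :=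
  is_derive (fun y => Re (f y)) x (Re l) /\
  is_derive (fun y => Im (f y)) x (Im l).

Lemma Cder_CDerive f x l : Cder f x l -> CDerive f x = l.
Proof.
intros [H1 H2]; unfold CDerive.
rewrite (is_derive_unique _ _ _ H1) (is_derive_unique _ _ _ H2).
now destruct l.
Qed.

Lemma Cder_differentiable f x l : Cder f x l -> differentiable f x.
Proof.
intros [H1 H2].
exists (@plus C_R_NormedModule (@scal R_AbsRing C_R_NormedModule (Re l) (1, 0))
              (@scal R_AbsRing C_R_NormedModule (Im l) (0, 1))).
apply (@is_derive_ext R_AbsRing C_R_NormedModule
  (fun y => @plus C_R_NormedModule (@scal R_AbsRing C_R_NormedModule (Re (f y)) (1, 0))
              (@scal R_AbsRing C_R_NormedModule (Im (f y)) (0, 1)))).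
  intros t; destruct (f t) as [u v]; cbv -[Rplus Rmult].
  apply injective_projections; simpl; ring.
apply: is_derive_plus; apply: is_derive_scal_l; assumption.
Qed.

(** Both components are continuous linear functionals, so they commute with
    differentiation. *)
Lemma differentiable_Cder f x : differentiable f x -> Cder f x (CDerive f x).
Proof.
intros [l Hl].
assert (H : Cder f x l).
  split.
  - apply (filterdiff_ext_lin _ (fun y => fst (@scal R_AbsRing C_R_NormedModule y l))).
    + apply (filterdiff_comp' f (fun u : C_R_NormedModule => fst u)) => //.
      apply filterdiff_linear, is_linear_fst.
    + done.
  - apply (filterdiff_ext_lin _ (fun y => snd (@scal R_AbsRing C_R_NormedModule y l))).
    + apply (filterdiff_comp' f (fun u : C_R_NormedModule => snd u)) => //.
      apply filterdiff_linear, is_linear_snd.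
    + done.
now rewrite (Cder_CDerive _ _ _ H).
Qed.

Lemma Cder_ext_loc f g x l :
  locally x (fun y => f y = g y) -> Cder f x l -> Cder g x l.
Proof.
intros H [H1 H2]; split.
- apply: is_derive_ext_loc H1; apply: filter_imp H => y /= -> //.
- apply: is_derive_ext_loc H2; apply: filter_imp H => y /= -> //.
Qed.

Lemma Cder_ext f g x l : (forall y, f y = g y) -> Cder f x l -> Cder g x l.
Proof. intros H; apply Cder_ext_loc; exists (mkposreal 1 Rlt_0_1); auto. Qed.

Lemma Cder_const c x : Cder (fun _ => c) x 0.
Proof. split; apply: is_derive_const. Qed.

Lemma Cder_plus f g x l k :
  Cder f x l -> Cder g x k -> Cder (fun y => f y + g y)%C x (l + k)%C.
Proof. intros [H1 H2] [H3 H4]; split; simpl; apply: is_derive_plus => //. Qed.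

Lemma Cder_mult f g x l k :
  Cder f x l -> Cder g x k ->
  Cder (fun y => f y * g y)%C x (l * g x + f x * k)%C.
Proof.
intros [H1 H2] [H3 H4]; split; simpl.
- evar_last.
    apply: is_derive_minus; apply: is_derive_mult; eauto; intros; apply Rmult_comm.
  simpl; rewrite /minus /plus /opp /mult /=; unfold Re, Im; ring.
- evar_last.
    apply: is_derive_plus; apply: is_derive_mult; eauto; intros; apply Rmult_comm.
  simpl; rewrite /minus /plus /opp /mult /=; unfold Re, Im; ring.
Qed.

Lemma Cder_scal c f x l : Cder f x l -> Cder (fun y => c * f y)%C x (c * l)%C.
Proof.
intros H; replace (c * l)%C with (0 * f x + c * l)%C by ring.
apply (Cder_mult (fun _ => c)); auto using Cder_const.
Qed.

Lemma Cder_RtoC f x l : is_derive f x l -> Cder (fun y => RtoC (f y)) x (RtoC l).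
Proof. intros H; split; simpl; auto; apply: is_derive_const. Qed.

Lemma Cder_pow f x l n :
  Cder f x l -> Cder (fun y => f y ^ S n)%C x (RtoC (INR (S n)) * l * f x ^ n)%C.
Proof.
intros H; induction n as [|n IH].
  apply (Cder_ext f); [intros; simpl; ring|].
  now replace (RtoC (INR 1) * l * f x ^ 0)%C with l by (simpl; ring).
apply (Cder_ext (fun y => f y * f y ^ S n)%C); [reflexivity|].
replace (RtoC (INR (S (S n))) * l * f x ^ S n)%C
  with (l * f x ^ S n + f x * (RtoC (INR (S n)) * l * f x ^ n))%C.
  now apply Cder_mult.
rewrite (S_INR (S n)) RtoC_plus; simpl Cpow; ring.
Qed.

Lemma Cder_sum_n (f : nat -> R -> C) (l : nat -> C) x n :
  (forall k, (k <= n)%nat -> Cder (f k) x (l k)) ->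
  Cder (fun y => sum_n (fun k => f k y) n) x (sum_n l n).
Proof.
induction n as [|n IH]; intros H.
  rewrite sum_O; apply (Cder_ext (f 0%nat)); [intros; now rewrite sum_O|auto].
rewrite sum_Sn.
apply (Cder_ext (fun y => sum_n (fun k => f k y) n + f (S n) y)%C).
  intros; now rewrite sum_Sn.
apply Cder_plus; auto.
Qed.

Lemma Cder_comp f g x l d :
  Cder f (g x) l -> is_derive g x d ->
  Cder (fun y => f (g y)) x (RtoC d * l)%C.
Proof.
intros [H1 H2] Hg; split.
- evar_last; [apply (is_derive_comp (fun y => Re (f y)) g x _ _ H1 Hg)|].
  unfold scal, Re; simpl; unfold mult; simpl; ring.
- evar_last; [apply (is_derive_comp (fun y => Im (f y)) g x _ _ H2 Hg)|].
  unfold scal, Im; simpl; unfold mult; simpl; ring.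
Qed.

Lemma Cmod_le_Re_Im (z : C) : Cmod z <= Rabs (Re z) + Rabs (Im z).
Proof.
rewrite {1}(_ : z = (RtoC (Re z) + RtoC (Im z) * Ci)%C).
  eapply Rle_trans; [apply Cmod_triangle|].
  rewrite Cmod_mult !Cmod_R.
  replace (Cmod Ci) with 1; [lra|].
  unfold Cmod; simpl; rewrite -{1}sqrt_1; f_equal; ring.
destruct z; apply injective_projections; unfold Re, Im; simpl; ring.
Qed.

Lemma Cder_bounded u d :
  (forall t, 0 <= t <= 1 -> Cder u t (d t)) ->
  exists M, forall t, 0 <= t <= 1 -> Cmod (u t) <= M.
Proof.
intros H.
assert (Hc : forall v : R -> R, (forall t, 0 <= t <= 1 -> ex_derive v t) ->
  exists M, forall t, 0 <= t <= 1 -> Rabs (v t) <= M).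
  intros v Hv.
  destruct (continuity_ab_maj (fun t => Rabs (v t)) 0 1) as [t0 [Ht0 _]]; try lra.
    intros t Ht; apply continuity_pt_filterlim.
    apply: continuous_comp.
      apply: ex_derive_continuous; auto.
    apply continuous_Rabs.
  exists (Rabs (v t0)); auto.
destruct (Hc (fun t => Re (u t))) as [M1 H1].
  intros t Ht; exists (Re (d t)); now apply H.
destruct (Hc (fun t => Im (u t))) as [M2 H2].
  intros t Ht; exists (Im (d t)); now apply H.
exists (M1 + M2); intros t Ht.
eapply Rle_trans; [apply Cmod_le_Re_Im|].
specialize (H1 t Ht); specialize (H2 t Ht); lra.
Qed.

Lemma Cmod_Cpow (z : C) n : Cmod (z ^ n) = Cmod z ^ n.
Proof.
induction n as [|n IH]; [apply Cmod_1|].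
simpl; now rewrite Cmod_mult IH.
Qed.

Lemma RtoC_neq0 x : x <> 0 -> RtoC x <> 0%C.
Proof. intros H E; apply H; now injection E. Qed.

Lemma RtoC_Cpow x n : RtoC (x ^ n) = (RtoC x ^ n)%C.
Proof. induction n as [|n IH]; [auto|simpl; now rewrite RtoC_mult IH]. Qed.

Lemma sum_n_C_scal (c : C) (a : nat -> C) n :
  (c * sum_n a n)%C = sum_n (fun k => c * a k)%C n.
Proof. symmetry; apply: (sum_n_mult_l (K := C_Ring)). Qed.

Lemma Re_sum_n (a : nat -> C) n : Re (sum_n a n) = sum_n (fun k => Re (a k)) n.
Proof. induction n; [now rewrite !sum_O|rewrite !sum_Sn -IHn; reflexivity]. Qed.

Lemma Im_sum_n (a : nat -> C) n : Im (sum_n a n) = sum_n (fun k => Im (a k)) n.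
Proof. induction n; [now rewrite !sum_O|rewrite !sum_Sn -IHn; reflexivity]. Qed.

Lemma is_series_C (a : nat -> C) (l : C) :
  @is_series C_AbsRing C_NormedModule a l <->
  is_series (fun n => Re (a n)) (Re l) /\ is_series (fun n => Im (a n)) (Im l).
Proof.
unfold is_series; rewrite !filterlim_locally.
split.
- intros H; split; intros eps; generalize (H eps); apply: filter_imp => n [H1 H2].
  + rewrite -Re_sum_n; exact H1.
  + rewrite -Im_sum_n; exact H2.
- intros [H1 H2] eps; generalize (filter_and _ _ (H1 eps) (H2 eps)).
  apply: filter_imp => n [H3 H4]; split.
  + rewrite -Re_sum_n in H3; exact H3.
  + rewrite -Im_sum_n in H4; exact H4.
Qed.

Lemma is_Cpseries_series a z l :
  is_Cpseries a z l <->
  @is_series C_AbsRing C_NormedModule (fun n => z ^ n * a n)%C l.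
Proof.
assert (E : forall n, (scal (pow_n (K := C_AbsRing) z n) (a n) : C_NormedModule) = (z ^ n * a n)%C).
  intros n; f_equal; induction n; simpl; auto; now rewrite IHn.
unfold is_Cpseries, is_pseries; split; apply is_series_ext; auto.
Qed.

Lemma is_series_C_unique (a : nat -> C) (l1 l2 : C) :
  @is_series C_AbsRing C_NormedModule a l1 ->
  @is_series C_AbsRing C_NormedModule a l2 -> l1 = l2.
Proof.
intros H1 H2; apply is_series_C in H1; apply is_series_C in H2.
destruct H1 as [H1 H3], H2 as [H2 H4].
apply injective_projections.
- exact (eq_trans (eq_sym (is_series_unique _ _ H1)) (is_series_unique _ _ H2)).
- exact (eq_trans (eq_sym (is_series_unique _ _ H3)) (is_series_unique _ _ H4)).
Qed.

(** * Taylor series from derivative bounds *)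

(** In the derivative of this polynomial in 1 - t all terms cancel in pairs
    except the last one. *)
Lemma taylor_telescope (h : nat -> R -> R) N t :
  (forall n, is_derive (h n) t (h (S n) t)) ->
  is_derive (fun t => sum_n (fun n => h n t * ((1 - t) ^ n / INR (fact n))) N) t
    (h (S N) t * ((1 - t) ^ N / INR (fact N))).
Proof.
intros Hd; induction N as [|N IH].
  apply is_derive_ext with (h 0%nat).
    intros; rewrite sum_O; simpl; field.
  evar_last; [apply Hd|simpl; field].
apply is_derive_ext with (fun t => plus
  (sum_n (fun n => h n t * ((1 - t) ^ n / INR (fact n))) N)
  (h (S N) t * ((1 - t) ^ S N / INR (fact (S N))))).
  intros; now rewrite sum_Sn.
evar_last.
  apply: is_derive_plus; [apply IH|].
  apply: is_derive_mult; [apply Hd| |intros; apply Rmult_comm].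
  apply: is_derive_div.
  + apply: is_derive_pow; apply: is_derive_minus; [apply: is_derive_const|apply: is_derive_id].
  + apply: is_derive_const.
  + apply INR_fact_neq_0.
rewrite fact_simpl mult_INR.
assert (H1 := INR_fact_neq_0 N); assert (H2 := not_0_INR (S N) (Nat.neq_succ_0 N)).
rewrite /plus /minus /opp /mult /zero /one /plus /opp /=.
field; auto.
Qed.

(** The mean value theorem for the function of [taylor_telescope], whose
    values at 0 and at 1 are the Taylor polynomial and h 0 1. The denominator
    is N! instead of (N+1)!; the geometric factor in [taylor_series] absorbs
    the difference. *)
Lemma taylor_real (h : nat -> R -> R) N B :
  (forall n t, 0 <= t <= 1 -> is_derive (h n) t (h (S n) t)) ->
  (forall t, 0 <= t <= 1 -> Rabs (h (S N) t) <= B) ->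
  Rabs (sum_n (fun n => h n 0 / INR (fact n)) N - h 0%nat 1) <= B / INR (fact N).
Proof.
intros Hd HB.
destruct (MVT_gen
  (fun t => sum_n (fun n => h n t * ((1 - t) ^ n / INR (fact n))) N) 0 1
  (fun t => h (S N) t * ((1 - t) ^ N / INR (fact N)))) as [c [Hc E]].
- intros t; rewrite Rmin_left ?Rmax_right; try lra; intros Ht.
  apply taylor_telescope; intros; apply Hd; lra.
- intros t; rewrite Rmin_left ?Rmax_right; try lra; intros Ht.
  apply derivable_continuous_pt, ex_derive_Reals_0; eexists.
  apply taylor_telescope; intros; apply Hd; lra.
- rewrite Rmin_left ?Rmax_right in Hc; try lra.
  assert (E0 : sum_n (fun n => h n 0 * ((1 - 0) ^ n / INR (fact n))) N =
    sum_n (fun n => h n 0 / INR (fact n)) N).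
    apply sum_n_ext; intros n; rewrite Rminus_0_r pow1; unfold Rdiv; now rewrite Rmult_1_l.
  assert (E1 : sum_n (fun n => h n 1 * ((1 - 1) ^ n / INR (fact n))) N = h 0%nat 1).
    clear; induction N as [|N IH].
      rewrite sum_O; simpl; field.
    rewrite sum_Sn IH; replace (1 - 1) with 0 by ring; rewrite pow_ne_zero //.
    unfold plus; simpl; unfold Rdiv; ring.
  rewrite E0 E1 in E.
  rewrite Rabs_minus_sym E Rminus_0_r Rmult_1_r Rabs_mult.
  unfold Rdiv; rewrite Rabs_mult -RPow_abs.
  assert (Hf := INR_fact_lt_0 N).
  rewrite (Rabs_pos_eq (/ _)); [|left; now apply Rinv_0_lt_compat].
  rewrite -Rmult_assoc; apply Rmult_le_compat_r.
    left; now apply Rinv_0_lt_compat.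
  rewrite -(Rmult_1_r B); apply Rmult_le_compat; auto using Rabs_pos.
    apply pow_le, Rabs_pos.
  assert (P := pow_incr (Rabs (1 - c)) 1 N); rewrite pow1 in P.
  apply P; split; [apply Rabs_pos|apply Rabs_le; lra].
Qed.

Lemma is_series_of_bound (a : nat -> R) l (K : R) :
  (forall N, Rabs (sum_n a N - l) <= K * (1 / 2) ^ N) -> is_series a l.
Proof.
intros H; unfold is_series.
assert (L : is_lim_seq (fun N => sum_n a N - l) 0).
  apply is_lim_seq_abs_0.
  apply is_lim_seq_le_le with (fun _ => 0) (fun N => K * (1 / 2) ^ N).
  - intros N; split; [apply Rabs_pos|apply H].
  - apply is_lim_seq_const.
  - replace (Finite 0) with (Rbar_mult K 0) by (simpl; f_equal; ring).
    apply is_lim_seq_scal_l, is_lim_seq_geom.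
    rewrite Rabs_pos_eq; lra.
change (is_lim_seq (sum_n a) l).
apply is_lim_seq_ext with (fun N => (sum_n a N - l) + l).
  intros; ring.
evar_last.
  apply is_lim_seq_plus'; [apply L|apply is_lim_seq_const].
f_equal; ring.
Qed.

Lemma Sn_le_pow2 n : INR (S n) <= 2 ^ n.
Proof.
induction n; [simpl; lra|].
rewrite (S_INR (S n)); simpl pow.
assert (1 <= 2 ^ n) by (apply pow_R1_Rle; lra); lra.
Qed.

Lemma taylor_series_real (h : nat -> R -> R) K :
  (forall n t, 0 <= t <= 1 -> is_derive (h n) t (h (S n) t)) ->
  (forall n t, 0 <= t <= 1 -> Rabs (h n t) <= K * INR (fact n) / 4 ^ n) ->
  is_series (fun n => h n 0 / INR (fact n)) (h 0%nat 1).
Proof.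
intros Hd HB; apply is_series_of_bound with K; intros N.
eapply Rle_trans; [apply (taylor_real h N (K * INR (fact (S N)) / 4 ^ S N)); auto|].
rewrite fact_simpl mult_INR.
assert (HK : 0 <= K).
  assert (H := HB 0%nat 0 ltac:(lra)); simpl in H.
  generalize (Rabs_pos (h 0%nat 0)); lra.
assert (H1 := INR_fact_lt_0 N); assert (H2 := Sn_le_pow2 N).
assert (H4 : 0 < 2 ^ N) by (apply pow_lt; lra).
replace (4 ^ S N) with (4 * (2 ^ N * 2 ^ N)).
  2: simpl; rewrite -Rpow_mult_distr; do 2 f_equal; ring.
replace (K * (INR (S N) * INR (fact N)) / (4 * (2 ^ N * 2 ^ N)) / INR (fact N))
  with (K * (INR (S N) / 2 ^ N) * / 4 * (/ 2 ^ N)) by (field; lra).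
rewrite Rpow_mult_distr pow1 pow_inv Rmult_1_l.
apply Rmult_le_compat_r; [left; now apply Rinv_0_lt_compat|].
assert (INR (S N) / 2 ^ N <= 1) by (apply Rle_div_l; lra).
assert (K * (INR (S N) / 2 ^ N) <= K * 1) by (apply Rmult_le_compat_l; auto).
lra.
Qed.

(** The growth n!/4^n leaves a remainder of order (n+1)/4^n <= 1/2^n, because
    n + 1 <= 2^n. *)
Lemma taylor_series (h : nat -> R -> C) K :
  (forall n t, 0 <= t <= 1 -> Cder (h n) t (h (S n) t)) ->
  (forall n t, 0 <= t <= 1 -> Cmod (h n t) <= K * INR (fact n) / 4 ^ n) ->
  @is_series C_AbsRing C_NormedModule
    (fun n => RtoC (/ INR (fact n)) * h n 0)%C (h 0%nat 1).
Proof.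
intros Hd HB; apply is_series_C; split.
- apply is_series_ext with (fun n => Re (h n 0) / INR (fact n)).
    intros n; unfold Rdiv, Re, Im; simpl; ring.
  apply (taylor_series_real (fun n t => Re (h n t)) K).
    intros n t Ht; now apply (Hd n t Ht).
  intros n t Ht; apply Rle_trans with (Cmod (h n t)); auto using re_le_Cmod.
- apply is_series_ext with (fun n => Im (h n 0) / INR (fact n)).
    intros n; unfold Rdiv, Re, Im; simpl; ring.
  apply (taylor_series_real (fun n t => Im (h n t)) K).
    intros n t Ht; now apply (Hd n t Ht).
  intros n t Ht; apply Rle_trans with (Cmod (h n t)); auto.
  eapply Rle_trans; [apply Rmax_r|apply Rmax_Cmod].
Qed.

(** * Ladders of functions *)

(** If T n k has derivative e n k * T (n+1) k + T (n+1) (k+1), then the n-th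
    derivative of T 0 0 is the combination of the T n k with these
    coefficients. The Stirling numbers are the case e n k = m (k / m); other
    rates e describe iterated derivatives with respect to x. *)
Fixpoint ladder_coef (e : nat -> nat -> R) (n k : nat) : R :=
  match n with
  | O => match k with O => 1 | S _ => 0 end
  | S n' => e n' k * ladder_coef e n' k
            + match k with O => 0 | S k' => ladder_coef e n' k' end
  end.

Definition stirling_rate (m n k : nat) : R := INR (m * (k / m)).

Lemma ladder_coef_Stirling m n k :
  ladder_coef (stirling_rate m) n k = INR (mStirling2 m n k).
Proof.
revert k; induction n as [|n IH]; intros k; [now destruct k|].
simpl; rewrite plus_INR mult_INR IH; destruct k; simpl; now rewrite ?IH.
Qed.

Lemma ladder_coef_gt e n k : (n < k)%nat -> ladder_coef e n k = 0.
Proof.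
revert k; induction n as [|n IH]; intros k H; (destruct k; [lia|]); simpl; auto.
rewrite !IH; try lia; ring.
Qed.

(** One differentiation step: summation by parts moves the shift from the
    functions to the coefficients, and the boundary term is the new top
    coefficient. *)
Lemma ladder_sum e n (F : nat -> C) :
  sum_n (fun k => RtoC (ladder_coef e n k) * (RtoC (e n k) * F k + F (S k)))%C n
  = sum_n (fun k => RtoC (ladder_coef e (S n) k) * F k)%C (S n).
Proof.
assert (H : forall N,
  (sum_n (fun k => RtoC (ladder_coef e (S n) k) * F k)%C N
   + RtoC (ladder_coef e n N) * F (S N))%C =
  sum_n (fun k => RtoC (ladder_coef e n k) * (RtoC (e n k) * F k + F (S k)))%C N).
  induction N as [|N IH].
    rewrite !sum_O; simpl; rewrite RtoC_plus RtoC_mult; ring.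
  rewrite !sum_Sn -IH.
  change (ladder_coef e (S n) (S N)) with
    (e n (S N) * ladder_coef e n (S N) + ladder_coef e n N).
  rewrite RtoC_plus RtoC_mult /plus /=; ring.
rewrite -H sum_Sn; simpl ladder_coef.
rewrite (ladder_coef_gt e n (S n)); auto.
now rewrite Rmult_0_r Rplus_0_l.
Qed.

Lemma ladder_derive e (T : nat -> nat -> R -> C) n t :
  (forall k, (k <= n)%nat ->
     Cder (T n k) t (RtoC (e n k) * T (S n) k t + T (S n) (S k) t)%C) ->
  Cder (fun t => sum_n (fun k => RtoC (ladder_coef e n k) * T n k t)%C n) t
       (sum_n (fun k => RtoC (ladder_coef e (S n) k) * T (S n) k t)%C (S n)).
Proof.
intros H; rewrite -ladder_sum.
apply Cder_sum_n; intros k Hk; apply Cder_scal; auto.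
Qed.

(** Controls the n-th derivative when the k-th rung is O(X^k). *)
Definition ladder_weight (e : nat -> nat -> R) (X : R) (n : nat) : R :=
  sum_n (fun k => Rabs (ladder_coef e n k) * X ^ k) n.

Lemma sum_n_le (a b : nat -> R) n :
  (forall k, (k <= n)%nat -> a k <= b k) -> sum_n a n <= sum_n b n.
Proof. rewrite !sum_n_Reals; apply sum_Rle. Qed.

Lemma Cmod_sum_n (a : nat -> C) n :
  Cmod (sum_n a n) <= sum_n (fun k => Cmod (a k)) n.
Proof.
induction n as [|n IH]; [rewrite !sum_O; lra|].
rewrite !sum_Sn; eapply Rle_trans; [apply Cmod_triangle|].
apply Rplus_le_compat_r; auto.
Qed.

Lemma sum_n_scal (c : R) (a : nat -> R) n :
  c * sum_n a n = sum_n (fun k => c * a k) n.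
Proof. symmetry; apply: (sum_n_mult_l (K := R_Ring)). Qed.

Lemma ladder_Cmod_le e (F : nat -> C) n B X :
  (forall k, (k <= n)%nat -> Cmod (F k) <= B * X ^ k) ->
  Cmod (sum_n (fun k => RtoC (ladder_coef e n k) * F k)%C n)
  <= B * ladder_weight e X n.
Proof.
intros H; eapply Rle_trans; [apply Cmod_sum_n|].
unfold ladder_weight; rewrite sum_n_scal.
apply sum_n_le; intros k Hk; rewrite Cmod_mult Cmod_R.
rewrite -Rmult_assoc (Rmult_comm B) Rmult_assoc.
apply Rmult_le_compat_l; auto using Rabs_pos.
Qed.

(** The n-th derivative of T 0 0 is a ladder combination, so a bound on the
    weights is a bound on the Taylor remainder. *)
Lemma ladder_taylor e (T : nat -> nat -> R -> C) (B : nat -> R) X K :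
  (forall n k t, 0 <= t <= 1 ->
     Cder (T n k) t (RtoC (e n k) * T (S n) k t + T (S n) (S k) t)%C) ->
  (forall n k t, (k <= n)%nat -> 0 <= t <= 1 -> Cmod (T n k t) <= B n * X ^ k) ->
  (forall n, B n * ladder_weight e X n <= K * INR (fact n) / 4 ^ n) ->
  @is_series C_AbsRing C_NormedModule
    (fun n => RtoC (/ INR (fact n)) *
              sum_n (fun k => RtoC (ladder_coef e n k) * T n k 0) n)%C
    (T 0%nat 0%nat 1).
Proof.
intros Hd HB HK.
evar_last.
  apply (taylor_series
    (fun n t => sum_n (fun k => RtoC (ladder_coef e n k) * T n k t)%C n) K).
  - intros n t Ht; apply ladder_derive; auto.
  - intros n t Ht; eapply Rle_trans; [|apply HK].
    apply ladder_Cmod_le; auto.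
simpl; rewrite sum_O; simpl; ring.
Qed.

(** * Size of the Stirling numbers *)

Lemma mStirling2_gt m n k : (n < k)%nat -> mStirling2 m n k = 0%nat.
Proof. intros H; apply INR_eq; rewrite -ladder_coef_Stirling; now apply ladder_coef_gt. Qed.

Lemma mStirling2_diag m n : (n <= m)%nat -> mStirling2 m n n = 1%nat.
Proof.
induction n as [|n IH]; intros Hn; auto.
simpl; rewrite IH; [|lia].
rewrite (mStirling2_gt m n (S n)); lia.
Qed.

(** Up to n = m the recurrence only shifts, because all rates met on the way
    are 0. *)
Lemma mStirling2_low m n k : (k < n)%nat -> (n <= m)%nat -> mStirling2 m n k = 0%nat.
Proof.
revert k; induction n as [|n IH]; intros k Hk Hn; [lia|].
simpl; rewrite (Nat.div_small k m); [|lia].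
destruct k as [|k]; [lia|]; rewrite (IH k); lia.
Qed.

(** The factor 2 makes the induction close: the recurrence contributes two
    terms, each at most k (2k)^n. The bound does not depend on m because m (k
    / m) <= k. *)
Lemma mStirling2_fact_le m n k :
  INR (mStirling2 m n k) * INR (fact k) <= (2 * INR k) ^ n.
Proof.
revert k; induction n as [|n IH]; intros k.
  destruct k; simpl; lra.
simpl mStirling2; rewrite plus_INR mult_INR.
assert (Hm : INR (m * (k / m)) <= INR k) by apply le_INR, Nat.Div0.mul_div_le.
assert (Hk := pos_INR k); assert (Hp : 0 <= (2 * INR k) ^ n) by (apply pow_le; lra).
assert (H1 : INR (m * (k / m)) * (INR (mStirling2 m n k) * INR (fact k))
  <= INR k * (2 * INR k) ^ n).
  apply Rmult_le_compat; auto using pos_INR.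
  apply Rmult_le_pos; apply pos_INR.
assert (H2 : INR (match k with O => 0 | S k' => mStirling2 m n k' end) * INR (fact k)
  <= INR k * (2 * INR k) ^ n).
  destruct k as [|k]; [simpl; lra|].
  rewrite fact_simpl mult_INR.
  assert ((2 * INR k) ^ n <= (2 * INR (S k)) ^ n).
    apply pow_incr; generalize (pos_INR k); rewrite S_INR; lra.
  replace (INR (mStirling2 m n k) * (INR (S k) * INR (fact k))) with
    (INR (S k) * (INR (mStirling2 m n k) * INR (fact k))) by ring.
  apply Rmult_le_compat_l; auto.
  eapply Rle_trans; [apply IH|auto].
simpl pow; lra.
Qed.

Lemma pow_div_fact_le_exp x n : 0 <= x -> x ^ n / INR (fact n) <= exp x.
Proof.
intros Hx; eapply Rle_trans; [|apply (exp_ge_taylor x n Hx)].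
assert (H : forall k, 0 <= x ^ k / INR (fact k)).
  intros k; apply Rdiv_le_0_compat; [now apply pow_le|apply INR_fact_lt_0].
destruct n as [|n]; [apply Rle_refl|].
rewrite tech5; generalize (cond_pos_sum _ n H); lra.
Qed.

Lemma exp_INR_mult k x : exp (INR k * x) = exp x ^ k.
Proof.
induction k as [|k IH]; [now rewrite Rmult_0_l exp_0|].
rewrite S_INR Rmult_plus_distr_r Rmult_1_l exp_plus IH; simpl; ring.
Qed.

(** Since (4r)^n (2k)^n / n! <= e^(8rk), summing over k against X^k / k! gives
    at most exp (X e^(8r)), uniformly in n. As r is arbitrary, the Taylor
    series of a Stirling ladder is entire. *)
Lemma stirling_weight_le m X r n :
  0 <= X -> 0 <= r ->
  r ^ n * ladder_weight (stirling_rate m) X n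
  <= exp (X * exp (8 * r)) * INR (fact n) / 4 ^ n.
Proof.
intros HX Hr.
assert (H4 : 0 < 4 ^ n) by (apply pow_lt; lra).
assert (Hn := INR_fact_lt_0 n).
assert (H : (4 * r) ^ n * ladder_weight (stirling_rate m) X n
  <= INR (fact n) * exp (X * exp (8 * r))).
  eapply Rle_trans.
  2: { apply Rmult_le_compat_l; [lra|].
       apply (exp_ge_taylor (X * exp (8 * r)) n).
       apply Rmult_le_pos; auto; left; apply exp_pos. }
  unfold ladder_weight.
  rewrite -sum_n_Reals !sum_n_scal; apply sum_n_le; intros k _.
  rewrite ladder_coef_Stirling Rabs_pos_eq; [|apply pos_INR].
  assert (Hk := INR_fact_lt_0 k).
  apply Rmult_le_reg_r with (INR (fact k)); auto.
  replace (INR (fact n) * ((X * exp (8 * r)) ^ k / INR (fact k)) * INR (fact k))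
    with (X ^ k * (INR (fact n) * exp (8 * r) ^ k))
    by (rewrite Rpow_mult_distr; field; lra).
  replace ((4 * r) ^ n * (INR (mStirling2 m n k) * X ^ k) * INR (fact k))
    with (X ^ k * ((4 * r) ^ n * (INR (mStirling2 m n k) * INR (fact k)))) by ring.
  apply Rmult_le_compat_l; [now apply pow_le|].
  eapply Rle_trans.
    apply Rmult_le_compat_l; [apply pow_le; lra|apply mStirling2_fact_le].
  rewrite -Rpow_mult_distr.
  replace (4 * r * (2 * INR k)) with (INR k * (8 * r)) by ring.
  rewrite -exp_INR_mult (Rmult_comm (INR (fact n))).
  apply Rle_div_l; [lra|].
  apply pow_div_fact_le_exp.
  apply Rmult_le_pos; [apply pos_INR|lra].
rewrite Rpow_mult_distr in H.
apply (proj1 (Rle_div_r _ _ _ H4)); lra.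
Qed.

(** * Carrier systems *)

(** P k stands for x^k f_{k mod m} along the curve x e^(ts); its derivative is
    s times the ladder step for xD. *)
Lemma stirling_taylor m s (P : nat -> R -> C) M X :
  0 <= M -> 0 <= X ->
  (forall k t, 0 <= t <= 1 ->
     Cder (P k) t (s * (RtoC (INR (m * (k / m))) * P k t + P (S k) t))%C) ->
  (forall k t, 0 <= t <= 1 -> Cmod (P k t) <= M * X ^ k) ->
  is_Cpseries (fun n => RtoC (/ INR (fact n)) *
    sum_n (fun k => RtoC (INR (mStirling2 m n k)) * P k 0%R) n)%C s (P 0%nat 1).
Proof.
intros HM HX Hd HB; apply is_Cpseries_series.
evar_last.
eapply is_series_ext.
2: apply (ladder_taylor (stirling_rate m) (fun n k t => s ^ n * P k t)%C
     (fun n => M * Cmod s ^ n) X (M * exp (X * exp (8 * Cmod s)))).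
- intros n; simpl.
  replace (s ^ n * (RtoC (/ INR (fact n)) *
     sum_n (fun k : nat => RtoC (INR (mStirling2 m n k)) * P k 0%R) n))%C
    with (RtoC (/ INR (fact n)) * (s ^ n *
     sum_n (fun k : nat => RtoC (INR (mStirling2 m n k)) * P k 0%R) n))%C by ring.
  f_equal; rewrite sum_n_C_scal; apply sum_n_ext; intros k.
  rewrite ladder_coef_Stirling; Cring.
- intros n k t Ht.
  replace (RtoC (stirling_rate m n k) * (s ^ S n * P k t) + s ^ S n * P (S k) t)%C
    with (s ^ n * (s * (RtoC (INR (m * (k / m))) * P k t + P (S k) t)))%C
    by (unfold stirling_rate; simpl; ring).
  apply Cder_scal; auto.
- intros n k t _ Ht; rewrite Cmod_mult Cmod_Cpow.
  rewrite (Rmult_comm M) Rmult_assoc; apply Rmult_le_compat_l; auto.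
  apply pow_le, Cmod_ge_0.
- intros n.
  replace (M * exp (X * exp (8 * Cmod s)) * INR (fact n) / 4 ^ n)
    with (M * (exp (X * exp (8 * Cmod s)) * INR (fact n) / 4 ^ n))
    by (unfold Rdiv; ring).
  rewrite Rmult_assoc; apply Rmult_le_compat_l; auto.
  apply stirling_weight_le; auto using Cmod_ge_0.
- simpl; ring.
Qed.

Lemma finite_bound (u : nat -> R -> C) (Q : R -> Prop) m :
  (forall r, (r < m)%nat -> exists M, forall t, Q t -> Cmod (u r t) <= M) ->
  exists M, 0 <= M /\ forall r t, (r < m)%nat -> Q t -> Cmod (u r t) <= M.
Proof.
induction m as [|m IH]; intros H.
  exists 0; split; [lra|lia].
destruct IH as [M1 [H0 H1]]; auto.
destruct (H m) as [M2 H2]; auto.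
exists (Rmax M1 M2); split.
  eapply Rle_trans; [apply H0|apply Rmax_l].
intros r t Hr Ht.
destruct (Nat.eq_dec r m) as [->|Hn].
  eapply Rle_trans; [apply H2; auto|apply Rmax_r].
eapply Rle_trans; [apply H1; auto; lia|apply Rmax_l].
Qed.

Lemma carrier_Cder m U f r x :
  carrier_system m U f -> (r < m)%nat -> U x ->
  Cder (f r) x (f (Nat.modulo (r + 1) m) x - RtoC (INR r / x) * f r x)%C.
Proof.
intros [_ [Hp H]] Hr Hx; destruct (H r Hr x Hx) as [Hd E].
apply differentiable_Cder in Hd.
specialize (Hp x Hx).
assert (Hx0 : RtoC x <> 0%C) by (apply RtoC_neq0; lra).
replace (f (Nat.modulo (r + 1) m) x - RtoC (INR r / x) * f r x)%C
  with (CDerive (f r) x); auto.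
unfold xD in E.
unfold Rdiv; rewrite RtoC_mult RtoC_inv; try lra.
replace (CDerive (f r) x) with (/ RtoC x * (RtoC x * CDerive (f r) x))%C
  by (field; auto).
replace (RtoC x * CDerive (f r) x)%C with
  (RtoC x * f (Nat.modulo (r + 1) m) x - RtoC (INR r) * f r x)%C.
  field; auto.
rewrite -E; ring.
Qed.

(** For r = 0 these are the rungs of the Stirling ladder; the shift r is
    needed to reach the derivatives of f_r. *)
Definition carrier_monomial m (f : nat -> R -> C) r k (y : R) : C :=
  (RtoC (y ^ k) * f (Nat.modulo (r + k) m) y)%C.

Lemma carrier_monomial_Cder m U f r k y :
  (1 <= m)%nat -> carrier_system m U f -> U y ->
  Cder (carrier_monomial m f r k) y
    (RtoC (/ y) * (RtoC (INR k - INR (Nat.modulo (r + k) m)) * carrier_monomial m f r k y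
       + carrier_monomial m f r (S k) y))%C.
Proof.
intros Hm Hf Hy.
assert (Hp : 0 < y) by (apply Hf; auto).
assert (H := carrier_Cder m U f (Nat.modulo (r + k) m) y Hf
  (Nat.mod_upper_bound (r + k) m ltac:(lia)) Hy).
rewrite Nat.Div0.add_mod_idemp_l in H.
replace (r + k + 1)%nat with (r + S k)%nat in H by lia.
unfold carrier_monomial.
set (j := Nat.modulo (r + k) m) in *; set (j' := Nat.modulo (r + S k) m) in *.
assert (Hq : Cder (fun y => RtoC (y ^ k)) y (RtoC (INR k * y ^ k / y))).
  apply Cder_RtoC; auto_derive; auto.
  destruct k; [simpl; field; lra|].
  simpl Init.Nat.pred; simpl pow; field; lra.
evar_last; [apply (Cder_mult _ _ _ _ _ Hq H)|].
simpl pow; unfold Rdiv.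
rewrite !RtoC_mult !RtoC_minus.
assert (E : (RtoC (/ y) * RtoC y)%C = 1%C).
  rewrite -RtoC_mult Rinv_l //; lra.
transitivity (RtoC (/ y) * ((RtoC (INR k) - RtoC (INR j)) * (RtoC (y ^ k) * f j y))
  + (RtoC (/ y) * RtoC y) * RtoC (y ^ k) * f j' y)%C; [rewrite E; ring|ring].
Qed.

Lemma carrier_monomial_0_Cder m U f k y :
  (1 <= m)%nat -> carrier_system m U f -> U y ->
  Cder (carrier_monomial m f 0 k) y
    (RtoC (/ y) * (RtoC (INR (m * (k / m))) * carrier_monomial m f 0 k y
       + carrier_monomial m f 0 (S k) y))%C.
Proof.
intros Hm Hf Hy; assert (H := carrier_monomial_Cder m U f 0 k y Hm Hf Hy).
replace (INR (m * (k / m))) with (INR k - INR (Nat.modulo (0 + k) m)); auto.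
simpl; rewrite {1}(Nat.div_mod_eq k m) plus_INR; ring.
Qed.

Lemma stirling_sum_Cder m U f n y :
  (1 <= m)%nat -> carrier_system m U f -> U y ->
  Cder (stirling_sum m f n) y (RtoC (/ y) * stirling_sum m f (S n) y)%C.
Proof.
intros Hm Hf Hy.
assert (E : forall n z, stirling_sum m f n z =
  sum_n (fun k => RtoC (ladder_coef (stirling_rate m) n k) * carrier_monomial m f 0 k z)%C n).
  intros n' z; apply sum_n_ext; intros k.
  rewrite ladder_coef_Stirling; unfold carrier_monomial; simpl plus.
  now rewrite Cmult_assoc.
eapply Cder_ext; [intros z; symmetry; apply E|].
rewrite E -ladder_sum sum_n_C_scal.
apply Cder_sum_n; intros k _.
replace (RtoC (/ y) * _)%C with (RtoC (ladder_coef (stirling_rate m) n k) *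
  (RtoC (/ y) * (RtoC (stirling_rate m n k) * carrier_monomial m f 0 k y
       + carrier_monomial m f 0 (S k) y)))%C by ring.
apply Cder_scal, (carrier_monomial_0_Cder m U); auto.
Qed.

Lemma iter_xD_stirling_sum m U f n x :
  (1 <= m)%nat -> carrier_system m U f -> U x ->
  Nat.iter n xD (f 0%nat) x = stirling_sum m f n x.
Proof.
intros Hm Hf; revert x; induction n as [|n IH]; intros x Hx.
  unfold stirling_sum; rewrite sum_O.
  simpl Nat.iter; rewrite Nat.Div0.mod_0_l; simpl; ring.
assert (H : Cder (Nat.iter n xD (f 0%nat)) x (RtoC (/ x) * stirling_sum m f (S n) x)%C).
  eapply Cder_ext_loc; [|apply (stirling_sum_Cder m U f n x); auto].
  generalize (proj1 Hf x Hx); apply: filter_imp => y Hy; symmetry; auto.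
simpl Nat.iter; unfold xD at 1.
rewrite (Cder_CDerive _ _ _ H) Cmult_assoc -RtoC_mult Rinv_r; [ring|].
assert (0 < x) by (apply Hf; auto); lra.
Qed.

Lemma iter_xD_differentiable m U f n x :
  (1 <= m)%nat -> carrier_system m U f -> U x ->
  differentiable (Nat.iter n xD (f 0%nat)) x.
Proof.
intros Hm Hf Hx; eapply Cder_differentiable, Cder_ext_loc.
2: apply (stirling_sum_Cder m U f n x); auto.
generalize (proj1 Hf x Hx); apply: filter_imp => y Hy; symmetry.
apply (iter_xD_stirling_sum m U); auto.
Qed.

Lemma sum_n_C_last (a : nat -> C) n :
  (forall k, (k < n)%nat -> a k = 0%C) -> sum_n a n = a n.
Proof.
intros H; destruct n as [|n]; [apply sum_O|].
rewrite sum_Sn.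
assert (E : sum_n a n = RtoC 0).
  assert (P : forall N, (N <= n)%nat -> sum_n a N = RtoC 0).
    induction N as [|N IH]; intros HN; [rewrite sum_O; apply H; lia|].
    rewrite sum_Sn IH; [|lia]; rewrite H; [|lia]; unfold plus; simpl; ring.
  auto.
rewrite E; unfold plus; simpl; ring.
Qed.

(** Combined with the finite identity, n = m gives the equation (xD)^m f_0 =
    x^m f_0, and n = r < m gives (xD)^r f_0 = x^r f_r. *)
Lemma stirling_sum_low m f n x :
  (n <= m)%nat -> stirling_sum m f n x = (RtoC (x ^ n) * f (Nat.modulo n m) x)%C.
Proof.
intros Hn; unfold stirling_sum; rewrite sum_n_C_last.
  rewrite mStirling2_diag //; simpl; ring.
intros k Hk; rewrite mStirling2_low //; simpl; ring.
Qed.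

Lemma carrier_bound m f (g : R -> R) (d : R -> R) U :
  carrier_system m U f ->
  (forall t, 0 <= t <= 1 -> U (g t) /\ is_derive g t (d t)) ->
  exists M, 0 <= M /\ forall r t, (r < m)%nat -> 0 <= t <= 1 -> Cmod (f r (g t)) <= M.
Proof.
intros Hf Hg; apply (finite_bound (fun r t => f r (g t)) (fun t => 0 <= t <= 1)).
intros r Hr.
apply (Cder_bounded (fun t => f r (g t)) (fun t => RtoC (d t) *
  (f (Nat.modulo (r + 1) m) (g t) - RtoC (INR r / g t) * f r (g t)))%C).
intros t Ht; apply Cder_comp; [|now apply Hg].
apply (carrier_Cder m U); auto; now apply Hg.
Qed.

(** On (0, oo) the whole curve x e^(ut), 0 <= u <= 1, stays inside the domain,
    and compactness bounds the f_r on it. *)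
Lemma stirling_expansion m f x t :
  (1 <= m)%nat -> carrier_system m (fun x => 0 < x) f -> 0 < x ->
  is_Cpseries (stirling_series m f x) (RtoC t) (f 0%nat (x * exp t)).
Proof.
intros Hm Hf Hx.
set (g := fun u => x * exp (t * u)).
assert (Hg : forall u, 0 < g u /\ is_derive g u (t * g u)).
  intros u; split.
    apply Rmult_lt_0_compat; auto; apply exp_pos.
  unfold g; auto_derive; auto; ring.
destruct (carrier_bound m f g (fun u => t * g u) _ Hf ltac:(auto)) as [M [HM HB]].
assert (HX : forall u, 0 <= u <= 1 -> g u <= x * exp (Rabs t)).
  intros u Hu; apply Rmult_le_compat_l; [lra|].
  destruct (Rle_lt_or_eq_dec (t * u) (Rabs t)) as [H|H].
    apply Rle_trans with (Rabs t * u).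
      apply Rmult_le_compat_r; [lra|apply Rle_abs].
    rewrite -{2}(Rmult_1_r (Rabs t)); apply Rmult_le_compat_l; [apply Rabs_pos|lra].
    left; now apply exp_increasing.
  rewrite H; lra.
assert (HX0 : 0 <= x * exp (Rabs t)).
  apply Rmult_le_pos; [lra|left; apply exp_pos].
assert (H := stirling_taylor m (RtoC t) (fun k u => carrier_monomial m f 0 k (g u))
  M (x * exp (Rabs t)) HM HX0).
evar_last; [eapply is_pseries_ext; [|apply H]|].
- intros n; unfold stirling_series; f_equal; apply sum_n_ext; intros k.
  unfold carrier_monomial, g; rewrite Rmult_0_r exp_0 Rmult_1_r.
  simpl plus. now rewrite Cmult_assoc.
(* The factor g u from the derivative of the curve turns D into xD. *)
- intros k u Hu.
  evar_last.
    apply (Cder_comp (carrier_monomial m f 0 k) g u).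
      apply (carrier_monomial_0_Cder m _ f k (g u) Hm Hf); apply Hg.
    apply Hg.
  rewrite RtoC_mult.
  assert (E : (RtoC (g u) * RtoC (/ g u))%C = 1%C).
    rewrite -RtoC_mult Rinv_r //; generalize (proj1 (Hg u)); lra.
  rewrite Cmult_assoc -(Cmult_assoc (RtoC t)) E; ring.
- intros k u Hu; unfold carrier_monomial; rewrite Cmod_mult Cmod_R Rmult_comm.
  apply Rmult_le_compat; auto using Cmod_ge_0, Rabs_pos.
    apply HB; auto; apply Nat.mod_upper_bound; lia.
  rewrite -RPow_abs; apply pow_incr; split; [apply Rabs_pos|].
  rewrite Rabs_pos_eq; auto; left; apply Hg.
- unfold carrier_monomial; rewrite Nat.Div0.mod_0_l; unfold g.
  rewrite Rmult_1_r; simpl; ring.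
Qed.

(** * Analyticity of carrier systems *)

Lemma ladder_weight_ge0 e X n : 0 <= X -> 0 <= ladder_weight e X n.
Proof.
intros HX; unfold ladder_weight; rewrite sum_n_Reals; apply cond_pos_sum.
intros k; apply Rmult_le_pos; [apply Rabs_pos|now apply pow_le].
Qed.

Lemma sum_n_R_S (a : nat -> R) n : sum_n a (S n) = sum_n a n + a (S n).
Proof. apply: sum_Sn. Qed.

Lemma ladder_weight_step e X n L :
  0 <= X -> (forall k, (k <= n)%nat -> Rabs (e n k) <= L) ->
  ladder_weight e X (S n) <= (L + X) * ladder_weight e X n.
Proof.
intros HX HL.
(* The partial sums need the term that the shift pushes past N. *)
assert (H : forall N, (N <= n)%nat ->
  sum_n (fun k => Rabs (ladder_coef e (S n) k) * X ^ k) N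
   + Rabs (ladder_coef e n N) * X ^ (S N) <=
  sum_n (fun k => (L + X) * (Rabs (ladder_coef e n k) * X ^ k)) N).
  induction N as [|N IH]; intros HN.
    rewrite !sum_O; simpl ladder_coef; rewrite Rplus_0_r Rabs_mult.
    assert (P := Rmult_le_compat_r _ _ _ (Rabs_pos (ladder_coef e n 0)) (HL 0%nat HN)).
    simpl pow; lra.
  rewrite !sum_n_R_S.
  change (ladder_coef e (S n) (S N)) with
    (e n (S N) * ladder_coef e n (S N) + ladder_coef e n N).
  specialize (IH ltac:(lia)).
  assert (P1 := Rmult_le_compat_r _ _ _ (Rabs_pos (ladder_coef e n (S N))) (HL (S N) HN)).
  assert (P2 := Rabs_triang (e n (S N) * ladder_coef e n (S N)) (ladder_coef e n N)).
  rewrite Rabs_mult in P2.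
  assert (HXN : 0 <= X ^ S N) by now apply pow_le.
  assert (P3 : Rabs (e n (S N) * ladder_coef e n (S N) + ladder_coef e n N) * X ^ S N
    <= (L * Rabs (ladder_coef e n (S N)) + Rabs (ladder_coef e n N)) * X ^ S N).
    apply Rmult_le_compat_r; auto; lra.
  simpl pow in *; lra.
specialize (H n (Nat.le_refl n)); rewrite -sum_n_scal in H.
unfold ladder_weight at 1; rewrite sum_n_R_S.
change (ladder_coef e (S n) (S n)) with
    (e n (S n) * ladder_coef e n (S n) + ladder_coef e n n).
rewrite (ladder_coef_gt e n (S n)); last lia.
rewrite Rmult_0_r Rplus_0_l; exact H.
Qed.

(** For rates that grow linearly in n the weights grow factorially, which
    yields a positive radius of convergence. *)
Lemma ladder_weight_fact e X q n :
  0 <= X -> 0 <= q -> (forall n k, (k <= n)%nat -> Rabs (e n k) <= INR n + q) ->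
  ladder_weight e X n <= INR (fact n) * (q + X + 1) ^ n.
Proof.
intros HX Hq He; induction n as [|n IH].
  unfold ladder_weight; rewrite sum_O; simpl; rewrite Rabs_R1; lra.
eapply Rle_trans; [apply (ladder_weight_step e X n (INR n + q)); auto|].
rewrite fact_simpl mult_INR S_INR; simpl pow.
assert (Hn := pos_INR n).
replace ((INR n + 1) * INR (fact n) * ((q + X + 1) * (q + X + 1) ^ n))
  with (((INR n + 1) * (q + X + 1)) * (INR (fact n) * (q + X + 1) ^ n)) by ring.
apply Rmult_le_compat; auto using ladder_weight_ge0; [lra|nra].
Qed.

(** D maps y^-n y^k f_{r+k} to (k - ((r+k) mod m) - n) y^-(n+1) y^k f_{r+k} +
    y^-(n+1) y^(k+1) f_{r+k+1}. This is a ladder with rates O(n + m), so the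
    n-th derivative of f_r near x is at most K n! A^n and the Taylor series
    converges to f_r near x. *)
Lemma carrier_analytic m U f r x :
  (1 <= m)%nat -> carrier_system m U f -> (r < m)%nat -> U x -> analytic_at (f r) x.
Proof.
intros Hm Hf Hr Hx.
destruct (proj1 Hf x Hx) as [d Hd].
assert (Hd' : forall y, Rabs (y - x) < d -> U y) by exact Hd.
set (rho := d / 2).
assert (Hrho : 0 < rho < d) by (unfold rho; generalize (cond_pos d); lra).
assert (Hball : forall y, Rabs (y - x) <= rho -> U y) by (intros; apply Hd'; lra).
set (eta := x - rho).
assert (Heta : 0 < eta).
  apply Hf, Hball; unfold eta; replace (x - rho - x) with (- rho) by ring.
  rewrite Rabs_Ropp Rabs_pos_eq; lra.
destruct (carrier_bound m f (fun t => x + rho * (2 * t - 1)) (fun _ => 2 * rho) U Hf)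
  as [M [HM HB]].
  intros t Ht; split.
    apply Hball; replace (x + rho * (2 * t - 1) - x) with (rho * (2 * t - 1)) by ring.
    apply Rabs_le; nra.
  auto_derive; auto; ring.
assert (HB' : forall r y, (r < m)%nat -> Rabs (y - x) <= rho -> Cmod (f r y) <= M).
  intros j y Hj Hy; apply Rabs_le_between in Hy.
  (* The bound is stated on the parametrization of [x - rho, x + rho] by [0, 1]. *)
  replace y with (x + rho * (2 * ((y - x) / rho / 2 + 1 / 2) - 1)) by (field; lra).
  apply HB; auto.
  assert (-1 <= (y - x) / rho) by (apply (proj1 (Rle_div_r _ _ _ (proj1 Hrho))); lra).
  assert ((y - x) / rho <= 1) by (apply (proj2 (Rle_div_l _ _ _ (proj1 Hrho))); lra).
  lra.
set (X := x + rho).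
set (e := fun n k => INR k - INR (Nat.modulo (r + k) m) - INR n).
set (q := INR m).
assert (Hq : 0 <= q) by apply pos_INR.
assert (HX : 0 <= X) by (unfold X; generalize (proj1 (proj2 Hf) x Hx); lra).
assert (He : forall n k, (k <= n)%nat -> Rabs (e n k) <= INR n + q).
  intros n k Hk; unfold e, q; apply Rabs_le.
  assert (H1 := le_INR _ _ Hk); assert (H2 := pos_INR k).
  assert (H3 := pos_INR (Nat.modulo (r + k) m)).
  assert (H4 : INR (Nat.modulo (r + k) m) <= INR m).
    apply le_INR, Nat.lt_le_incl, Nat.mod_upper_bound; lia.
  lra.
set (A := q + X + 1).
assert (HA : 0 < A) by (unfold A; lra).
set (T := fun n k y => (RtoC ((/ y) ^ n) * carrier_monomial m f r k y)%C).
exists (fun n => RtoC (/ INR (fact n)) *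
  sum_n (fun k => RtoC (ladder_coef e n k) * T n k x) n)%C.
(* On |y - x| < eta / (4 A), where eta bounds y from below, the factors
   A^n of the weights and (|w| / eta)^n of the rungs multiply to at most 4^-n. *)
exists (Rmin rho (eta / (4 * A))); split.
  apply Rmin_pos; [lra|]; apply Rdiv_lt_0_compat; lra.
intros y Hy.
set (w := y - x) in *.
assert (Hw1 : Rabs w <= rho) by (generalize (Rmin_l rho (eta / (4 * A))); lra).
assert (Hw2 : Rabs w <= eta / (4 * A)) by (generalize (Rmin_r rho (eta / (4 * A))); lra).
assert (Hg : forall t, 0 <= t <= 1 -> Rabs (x + t * w - x) <= rho /\ eta <= x + t * w <= X).
  intros t Ht.
  assert (Rabs (x + t * w - x) <= rho).
    replace (x + t * w - x) with (t * w) by ring; rewrite Rabs_mult Rabs_pos_eq; try lra.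
    generalize (Rabs_pos w); nra.
  split; auto; apply Rabs_le_between in H; unfold eta, X; lra.
apply is_Cpseries_series.
evar_last.
eapply is_series_ext.
2: apply (ladder_taylor e (fun n k t => RtoC w ^ n * T n k (x + t * w)%R)%C
     (fun n => M * (Rabs w / eta) ^ n) X M).
- intros n; simpl.
  replace (RtoC w ^ n * (RtoC (/ INR (fact n)) *
     sum_n (fun k : nat => RtoC (ladder_coef e n k) * T n k x) n))%C
    with (RtoC (/ INR (fact n)) * (RtoC w ^ n *
     sum_n (fun k : nat => RtoC (ladder_coef e n k) * T n k x) n))%C by ring.
  f_equal; rewrite sum_n_C_scal; apply sum_n_ext; intros k.
  rewrite Rmult_0_l Rplus_0_r; Cring.
- intros n k t Ht.
  destruct (Hg t Ht) as [Hy1 Hy2].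
  set (g := fun t => x + t * w) in *.
  assert (Hp : 0 < g t) by (unfold g; lra).
  assert (Hgd : is_derive g t w) by (unfold g; auto_derive; auto; ring).
  assert (Hinv : Cder (fun y => RtoC ((/ y) ^ n)) (g t) (RtoC (- INR n * (/ g t) ^ S n))).
    apply Cder_RtoC; auto_derive; [lra|].
    destruct n; [simpl; field; lra|].
    simpl Init.Nat.pred; simpl pow; field; lra.
  assert (HT : Cder (T n k) (g t)
     (RtoC (e n k) * T (S n) k (g t) + T (S n) (S k) (g t))%C).
    evar_last.
      apply (Cder_mult _ _ _ _ _ Hinv
        (carrier_monomial_Cder m U f r k (g t) Hm Hf (Hball _ Hy1))).
    unfold T, e; rewrite !RtoC_minus; simpl pow; rewrite !RtoC_mult RtoC_opp; ring.
  change (fun t : R => RtoC w ^ n * T n k (x + t * w)%R)%C with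
    (fun t : R => RtoC w ^ n * T n k (g t))%C.
  evar_last.
    apply Cder_scal, (Cder_comp (T n k) g t _ _ HT Hgd).
  simpl Cpow; unfold g; ring.
- intros n k t _ Ht.
  destruct (Hg t Ht) as [Hy1 Hy2].
  unfold T, carrier_monomial; rewrite !Cmod_mult Cmod_Cpow !Cmod_R.
  rewrite -!RPow_abs !Rabs_inv !(Rabs_pos_eq (x + t * w)); try lra.
  assert (H1 : (Rabs w * / (x + t * w)) ^ n <= (Rabs w / eta) ^ n).
    apply pow_incr; split.
      apply Rmult_le_pos; [apply Rabs_pos|left; apply Rinv_0_lt_compat; lra].
    apply Rmult_le_compat_l; [apply Rabs_pos|apply Rinv_le_contravar; lra].
  assert (H2 : (x + t * w) ^ k <= X ^ k) by (apply pow_incr; lra).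
  assert (H3 : Cmod (f (Nat.modulo (r + k) m) (x + t * w)) <= M).
    apply HB'; auto; apply Nat.mod_upper_bound; lia.
  rewrite Rpow_mult_distr in H1.
  assert (P0 : 0 <= (x + t * w) ^ k) by (apply pow_le; lra).
  assert (P1 : 0 <= Rabs w ^ n * (/ (x + t * w)) ^ n).
    apply Rmult_le_pos; apply pow_le; [apply Rabs_pos|left; apply Rinv_0_lt_compat; lra].
  replace (Rabs w ^ n * ((/ (x + t * w)) ^ n *
     ((x + t * w) ^ k * Cmod (f (Nat.modulo (r + k) m) (x + t * w)))))
  with (Cmod (f (Nat.modulo (r + k) m) (x + t * w)) * (Rabs w ^ n * (/ (x + t * w)) ^ n) *
     (x + t * w) ^ k) by ring.
  apply Rmult_le_compat; auto.
    apply Rmult_le_pos; auto using Cmod_ge_0.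
  apply Rmult_le_compat; auto using Cmod_ge_0.
- intros n.
  assert (H4 : 0 < 4 ^ n) by (apply pow_lt; lra).
  assert (HwA : (Rabs w / eta) ^ n * A ^ n <= / 4 ^ n).
    rewrite -Rpow_mult_distr -pow_inv; apply pow_incr; split.
      apply Rmult_le_pos; [apply Rdiv_le_0_compat; auto using Rabs_pos|lra].
    apply Rmult_le_reg_r with (eta * / A).
      apply Rmult_lt_0_compat; auto; now apply Rinv_0_lt_compat.
    replace (Rabs w / eta * A * (eta * / A)) with (Rabs w) by (field; lra).
    replace (/ 4 * (eta * / A)) with (eta / (4 * A)) by (field; lra); auto.
  assert (HW := ladder_weight_fact e X q n HX Hq He); fold A in HW.
  assert (P : 0 <= (Rabs w / eta) ^ n).
    apply pow_le, Rdiv_le_0_compat; auto using Rabs_pos.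
  unfold Rdiv at 2; rewrite !Rmult_assoc; apply Rmult_le_compat_l; auto.
  apply Rle_trans with ((Rabs w / eta) ^ n * (INR (fact n) * A ^ n)).
    now apply Rmult_le_compat_l.
  replace ((Rabs w / eta) ^ n * (INR (fact n) * A ^ n)) with
    (INR (fact n) * ((Rabs w / eta) ^ n * A ^ n)) by ring.
  apply Rmult_le_compat_l; auto; apply pos_INR.
- unfold T, carrier_monomial; simpl pow; rewrite Nat.add_0_r Nat.mod_small //.
  replace (x + 1 * w) with y by (unfold w; ring); simpl; ring.
Qed.

(** * Complex power series along curves *)

Lemma is_Cseries_Cmod_le (a : nat -> C) (b : nat -> R) l L :
  @is_series C_AbsRing C_NormedModule a l -> is_series b L ->
  (forall n, Cmod (a n) <= b n) -> Cmod l <= L.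
Proof.
intros Ha Hb H.
assert (H1 : is_lim_seq (fun n => Cmod (sum_n a n)) (Cmod l)).
  apply (filterlim_comp _ _ _ (sum_n a) Cmod eventually (locally (l : C_NormedModule)) _ Ha).
  apply (filterlim_norm (K := C_AbsRing) (V := C_NormedModule)).
apply (is_lim_seq_le (fun n => Cmod (sum_n a n)) (sum_n b) (Cmod l) L); auto.
intros n; eapply Rle_trans; [apply Cmod_sum_n|apply sum_n_le; auto].
Qed.

(** Only the moduli of the coefficients matter, which makes this the radius of
    a real power series. *)
Definition radius_ge (a : nat -> C) (rho : R) : Prop :=
  Rbar_le rho (CV_radius (fun n => Cmod (a n))).

(** Convergence at a real point bounds the terms, and bounded terms already
    determine the radius. *)
Lemma radius_ge_of_real a rho :
  (forall r, 0 <= r < rho -> exists l, is_Cpseries a (RtoC r) l) -> radius_ge a rho.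
Proof.
intros H; unfold radius_ge.
destruct (CV_radius_bounded (fun n => Cmod (a n))) as [Hub _].
assert (H1 : forall r, 0 <= r < rho -> Rbar_le r (CV_radius (fun n => Cmod (a n)))).
  intros r Hr; apply Hub.
  destruct (H r Hr) as [l Hl].
  apply is_Cpseries_series, is_series_C in Hl; destruct Hl as [H1 H2].
  assert (B : forall u : nat -> R, ex_series u -> exists M, forall n, Rabs (u n) <= M).
    intros u Hu; apply ex_series_lim_0 in Hu.
    destruct (filterlim_bounded u) as [M HM]; [now exists 0|].
    exists M; intros n; apply HM.
  destruct (B _ (ex_intro _ _ H1)) as [M1 HM1].
  destruct (B _ (ex_intro _ _ H2)) as [M2 HM2].
  exists (M1 + M2); intros n.
  rewrite Rabs_pos_eq.
    rewrite -(Rabs_pos_eq (r ^ n)); [|apply pow_le; lra].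
    rewrite -Cmod_R -Cmod_mult Cmult_comm RtoC_Cpow.
    eapply Rle_trans; [apply Cmod_le_Re_Im|].
    now apply Rplus_le_compat.
  apply Rmult_le_pos; [apply Cmod_ge_0|apply pow_le; lra].
destruct (CV_radius (fun n => Cmod (a n))) as [c| |] eqn:E; simpl; auto.
- destruct (Rle_lt_dec rho c) as [Hc|Hc]; auto; exfalso.
  assert (Hc0 : Rbar_le 0 c) by (rewrite -E; apply CV_radius_ge_0).
  simpl in Hc0.
  assert (P := H1 ((c + rho) / 2) ltac:(lra)); simpl in P; lra.
- assert (P := CV_radius_ge_0 (fun n => Cmod (a n))); rewrite E in P; destruct P.
Qed.

Lemma radius_ge_summable a rho r :
  radius_ge a rho -> 0 <= r < rho -> ex_series (fun n => Cmod (a n) * r ^ n).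
Proof.
intros H Hr.
eapply ex_series_ext; [|apply (CV_disk_inside (fun n => Cmod (a n)) r)].
- intros n; cbv beta; rewrite Rabs_pos_eq //; apply Rmult_le_pos; [apply Cmod_ge_0|apply pow_le; lra].
- eapply Rbar_lt_le_trans; [|apply H]; simpl; rewrite Rabs_pos_eq; lra.
Qed.

Lemma radius_ge_converges a rho w :
  radius_ge a rho -> Cmod w < rho -> exists l, is_Cpseries a w l.
Proof.
intros H Hw.
destruct (@ex_series_le C_AbsRing C_CompleteNormedModule
  (fun n => w ^ n * a n)%C (fun n => Cmod (a n) * Cmod w ^ n)) as [l Hl].
- intros n; change (Cmod (w ^ n * a n) <= Cmod (a n) * Cmod w ^ n).
  rewrite Cmod_mult Cmod_Cpow Rmult_comm; lra.
- apply (radius_ge_summable a rho); auto; split; auto using Cmod_ge_0.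
- exists l; apply is_Cpseries_series; exact Hl.
Qed.

Definition Cderive_coef (a : nat -> C) (n : nat) : C := (RtoC (INR (S n)) * a (S n))%C.

(** Coefficients in powers of z - z0 of the product z * a, since z = z0 + (z -
    z0). *)
Definition mulz_coef (z0 : C) (a : nat -> C) (n : nat) : C :=
  (z0 * a n + match n with O => 0 | S k => a k end)%C.

Lemma radius_ge_derive a rho : radius_ge a rho -> radius_ge (Cderive_coef a) rho.
Proof.
unfold radius_ge; rewrite -(CV_radius_derive (fun n => Cmod (a n))).
rewrite (CV_radius_ext (fun n => Cmod (Cderive_coef a n)) (PS_derive (fun n => Cmod (a n)))); auto.
intros n; unfold Cderive_coef, PS_derive.
rewrite Cmod_mult Cmod_R Rabs_pos_eq //; apply pos_INR.
Qed.

Lemma is_Cpseries_mulz z0 a w l :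
  is_Cpseries a w l -> is_Cpseries (mulz_coef z0 a) w ((z0 + w) * l)%C.
Proof.
intros H.
assert (H1 := is_pseries_plus _ _ _ _ _
  (is_pseries_scal z0 a w l (Cmult_comm _ _) H) (is_pseries_incr_1 a w l H)).
replace ((z0 + w) * l)%C with (z0 * l + w * l)%C by ring.
eapply is_pseries_ext with (2 := H1).
intros n; destruct n; reflexivity.
Qed.

(** The new series converges at the same real points. *)
Lemma radius_ge_mulz z0 a rho : radius_ge a rho -> radius_ge (mulz_coef z0 a) rho.
Proof.
intros H; apply radius_ge_of_real; intros r Hr.
destruct (radius_ge_converges a rho (RtoC r) H) as [l Hl].
  rewrite Cmod_R Rabs_pos_eq; lra.
exists ((z0 + RtoC r) * l)%C; apply is_Cpseries_mulz; exact Hl.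
Qed.

Lemma is_derive_quadratic (v : R -> R) c x :
  locally x (fun y => Rabs (v y) <= c * (y - x) ^ 2) -> is_derive v x 0.
Proof.
intros [d Hd].
assert (H0 : v x = 0).
  assert (P := Hd x (ball_center x d)); rewrite Rminus_diag in P.
  simpl in P; rewrite Rmult_0_l Rmult_0_r in P.
  destruct (Req_dec (v x) 0) as [E|E]; auto.
  apply Rabs_pos_lt in E; lra.
assert (Hc : 0 <= c).
  assert (P := Hd (x + d / 2)).
  assert (Hdp := cond_pos d).
  assert (P1 : Rabs (v (x + d / 2)) <= c * (x + d / 2 - x) ^ 2).
    apply P; change (Rabs (x + d / 2 - x) < d).
    replace (x + d / 2 - x) with (d / 2) by ring; rewrite Rabs_pos_eq; lra.
  assert (P2 := Rabs_pos (v (x + d / 2))).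
  replace (x + d / 2 - x) with (d / 2) in P1 by ring.
  assert (0 < (d / 2) ^ 2) by (apply pow_lt; lra).
  destruct (Rle_lt_dec 0 c); auto; nra.
apply is_derive_Reals; intros eps Heps.
assert (Hm : 0 < Rmin d (eps / (c + 1))).
  apply Rmin_pos; [apply cond_pos|apply Rdiv_lt_0_compat; lra].
exists (mkposreal _ Hm); intros h Hh Hhd; simpl in Hhd.
rewrite H0 !Rminus_0_r.
assert (H1 : Rabs h < d) by (generalize (Rmin_l d (eps / (c + 1))); lra).
assert (H2 : Rabs h < eps / (c + 1)) by (generalize (Rmin_r d (eps / (c + 1))); lra).
assert (P : Rabs (v (x + h)) <= c * (x + h - x) ^ 2).
  apply Hd; change (Rabs (x + h - x) < d); now replace (x + h - x) with h by ring.
replace (x + h - x) with h in P by ring.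
assert (Hh0 := Rabs_pos_lt h Hh).
unfold Rdiv; rewrite Rabs_mult Rabs_inv.
apply Rlt_div_l; auto.
rewrite -(pow2_abs h) in P.
apply Rlt_div_r in H2; [|lra].
nra.
Qed.

Lemma Cder_Lipschitz g x l :
  Cder g x l ->
  exists L, 0 <= L /\ locally x (fun y => Cmod (g y - g x)%C <= L * Rabs (y - x)).
Proof.
assert (H : forall (v : R -> R) k, is_derive v x k ->
  locally x (fun y => Rabs (v y - v x) <= (Rabs k + 1) * Rabs (y - x))).
  intros v k Hv; apply is_derive_Reals in Hv.
  destruct (Hv 1 Rlt_0_1) as [d Hd]; exists d; intros y.
  change R in y; intros Hy; change (Rabs (y - x) < d) in Hy.
  destruct (Req_dec y x) as [->|Hn].
    rewrite !Rminus_diag Rabs_R0; lra.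
  assert (P := Hd (y - x) ltac:(lra) Hy).
  replace (x + (y - x)) with y in P by ring.
  assert (Hp : 0 < Rabs (y - x)) by (apply Rabs_pos_lt; lra).
  replace (v y - v x) with (((v y - v x) / (y - x) - k + k) * (y - x)) by (field; lra).
  rewrite Rabs_mult; apply Rmult_le_compat_r; [lra|].
  eapply Rle_trans; [apply Rabs_triang|lra].
intros [H1 H2].
exists ((Rabs (Re l) + 1) + (Rabs (Im l) + 1)); split.
  generalize (Rabs_pos (Re l)), (Rabs_pos (Im l)); lra.
generalize (filter_and _ _ (H _ _ H1) (H _ _ H2)); apply: filter_imp.
intros y [P1 P2]; eapply Rle_trans; [apply Cmod_le_Re_Im|].
rewrite Rmult_plus_distr_r; apply Rplus_le_compat; auto.
Qed.

(** A chain rule with the difference quotient of u along g replaced by a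
    quadratic bound: g is Lipschitz at x, so the remainder is quadratic in y -
    x and has derivative 0. *)
Lemma Cder_remainder (u g : R -> C) x g' l K :
  Cder g x g' ->
  locally x (fun y =>
    Cmod (u y - u x - l * (g y - g x))%C <= K * Cmod (g y - g x)%C ^ 2) ->
  Cder u x (g' * l)%C.
Proof.
intros Hg Hu.
destruct (Cder_Lipschitz g x g' Hg) as [L [HL0 HL]].
set (v := fun y => (u y - u x - l * (g y - g x))%C).
assert (Hv : locally x (fun y => Cmod (v y) <= (Rabs K * (L * L)) * (y - x) ^ 2)).
  generalize (filter_and _ _ Hu HL); apply: filter_imp => y [P1 P2].
  eapply Rle_trans; [apply P1|].
  apply Rle_trans with (Rabs K * Cmod (g y - g x)%C ^ 2).
    apply Rmult_le_compat_r; [apply pow_le, Cmod_ge_0|apply Rle_abs].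
  rewrite Rmult_assoc; apply Rmult_le_compat_l; [apply Rabs_pos|].
  rewrite -(pow2_abs (y - x)).
  replace (L * L * Rabs (y - x) ^ 2) with ((L * Rabs (y - x)) ^ 2) by ring.
  apply pow_incr; auto using Cmod_ge_0.
assert (Hv0 : Cder v x 0).
  split; apply (is_derive_quadratic _ (Rabs K * (L * L)));
  generalize Hv; apply: filter_imp => y Hy; (eapply Rle_trans; [|apply Hy]).
    apply re_le_Cmod.
  eapply Rle_trans; [apply Rmax_r|apply Rmax_Cmod].
apply (Cder_ext (fun y => v y + (u x + - l * g x + l * g y))%C).
  intros y; unfold v; ring.
replace (g' * l)%C with (0 + (0 + l * g'))%C by ring.
apply Cder_plus; auto; apply Cder_plus; [apply Cder_const|now apply Cder_scal].
Qed.

(** Multiplying the remainder of w^(n+1) by w' and adding (n+1) w^n (w' - w)^2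
    gives the remainder of w^(n+2). The extra factor r avoids a negative power
    of r at n = 0. *)
Lemma Cpow_remainder_le (w w' : C) r n :
  0 <= r -> Cmod w <= r -> Cmod w' <= r ->
  r * Cmod (w' ^ S n - w ^ S n - RtoC (INR (S n)) * w ^ n * (w' - w))%C
  <= INR (S n) ^ 2 * r ^ n * Cmod (w' - w)%C ^ 2.
Proof.
intros Hr Hw Hw'; induction n as [|n IH].
  replace (w' ^ 1 - w ^ 1 - RtoC (INR 1) * w ^ 0 * (w' - w))%C with (RtoC 0) by (simpl; ring).
  rewrite Cmod_0 Rmult_0_r; simpl INR; simpl pow.
  generalize (Cmod_ge_0 (w' - w)); nra.
set (F := (w' ^ S n - w ^ S n - RtoC (INR (S n)) * w ^ n * (w' - w))%C) in *.
replace (w' ^ S (S n) - w ^ S (S n) - RtoC (INR (S (S n))) * w ^ S n * (w' - w))%C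
  with (w' * F + RtoC (INR (S n)) * w ^ n * (w' - w) * (w' - w))%C
  by (unfold F; rewrite (S_INR (S n)) RtoC_plus; simpl Cpow; ring).
assert (Hn := pos_INR (S n)).
assert (Hd := Cmod_ge_0 (w' - w)).
set (d := Cmod (w' - w)) in *.
assert (Hrn : 0 <= r ^ n) by now apply pow_le.
apply Rle_trans with (r * (r * Cmod F + INR (S n) * r ^ n * d * d)).
  apply Rmult_le_compat_l; auto.
  eapply Rle_trans; [apply Cmod_triangle|].
  rewrite !Cmod_mult Cmod_Cpow Cmod_R Rabs_pos_eq //; fold d.
  apply Rplus_le_compat.
    apply Rmult_le_compat_r; auto using Cmod_ge_0.
  do 2 (apply Rmult_le_compat_r; auto).
  apply Rmult_le_compat_l; auto; apply pow_incr; auto using Cmod_ge_0.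
assert (P := Rmult_le_compat_l r _ _ Hr IH).
rewrite (S_INR (S n)); set (N := INR (S n)) in *.
assert (Q : 0 <= r * (r ^ n * (d * d) * (N + 1))).
  apply Rmult_le_pos; auto; apply Rmult_le_pos; [apply Rmult_le_pos|]; auto; [nra|lra].
change (r ^ S n) with (r * r ^ n).
replace ((N + 1) ^ 2 * (r * r ^ n) * d ^ 2) with
  (r * (N ^ 2 * r ^ n * d ^ 2) + N * r * r ^ n * d * d + r * (r ^ n * (d * d) * (N + 1)))
  by ring.
lra.
Qed.

(** The constants (n+1)^2 |a (n+1)| r^n sum up because they are the
    coefficients of (x A')' for A the series of moduli, which has the same
    radius. *)
Lemma Cpseries_remainder_le a rho r :
  radius_ge a rho -> 0 < r < rho ->
  exists K, forall w w' l l' d,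
    Cmod w <= r -> Cmod w' <= r ->
    is_Cpseries a w l -> is_Cpseries a w' l' -> is_Cpseries (Cderive_coef a) w d ->
    Cmod (l' - l - d * (w' - w))%C <= K * Cmod (w' - w)%C ^ 2.
Proof.
intros Ha Hr.
set (b := fun n => INR (S n) ^ 2 * r ^ n * Cmod (a (S n))).
assert (Hb : ex_series b).
  eapply ex_series_ext; [|apply (CV_disk_inside
    (PS_derive (PS_incr_1 (PS_derive (fun n => Cmod (a n))))) r)].
  - intros n; unfold PS_derive, PS_incr_1, b; rewrite Rabs_pos_eq; [Rring|].
    repeat (apply Rmult_le_pos; auto using pos_INR, Cmod_ge_0); apply pow_le; lra.
  - rewrite CV_radius_derive CV_radius_incr_1 CV_radius_derive.
    eapply Rbar_lt_le_trans; [|apply Ha]; simpl; rewrite Rabs_pos_eq; lra.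
destruct Hb as [S HS].
exists (S / r); intros w w' l l' d Hw Hw' Hl Hl' Hd.
rewrite is_Cpseries_series in Hl; rewrite is_Cpseries_series in Hl';
rewrite is_Cpseries_series in Hd.
apply Rmult_le_reg_l with r; [lra|].
replace (r * (S / r * Cmod (w' - w)%C ^ 2)) with (Cmod (w' - w)%C ^ 2 * S) by (field; lra).
replace r with (Cmod (RtoC r)) at 1 by (rewrite Cmod_R Rabs_pos_eq; lra).
rewrite -Cmod_mult.
apply (is_Cseries_Cmod_le
  (fun n => RtoC r * (a (Datatypes.S n) * (w' ^ Datatypes.S n - w ^ Datatypes.S n - RtoC (INR (Datatypes.S n)) * w ^ n * (w' - w))))%C
  (fun n => Cmod (w' - w)%C ^ 2 * b n)).
- apply (is_series_scal (K := C_AbsRing) (V := C_NormedModule) (RtoC r)).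
  assert (I : forall (z k : C), @is_series C_AbsRing C_NormedModule (fun n => z ^ n * a n)%C k ->
     @is_series C_AbsRing C_NormedModule (fun n => z ^ Datatypes.S n * a (Datatypes.S n))%C (k - a 0%nat)%C).
    intros z k Hk; apply (is_series_incr_1 (K := C_AbsRing) (V := C_NormedModule) (fun n => z ^ n * a n)%C).
    evar_last; [apply Hk|]; unfold plus; simpl; Cring.
  assert (H1 := is_series_minus _ _ _ _ (I _ _ Hl') (I _ _ Hl)).
  assert (H2 := is_series_scal (K := C_AbsRing) (V := C_NormedModule) (w' - w)%C _ _ Hd).
  assert (H3 := is_series_minus _ _ _ _ H1 H2).
  evar_last; [eapply is_series_ext; [|apply H3]|].
    intros n; unfold plus, opp, scal, mult, Cderive_coef; cbn -[INR Cpow].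
    unfold mult; cbn -[INR Cpow]; Cring.
  unfold plus, opp, scal; simpl; unfold mult; simpl; Cring.
- apply (is_series_scal (K := R_AbsRing) (V := R_NormedModule)); exact HS.
- intros n; rewrite !Cmod_mult Cmod_R Rabs_pos_eq; [|lra].
  assert (P := Cpow_remainder_le w w' r n ltac:(lra) Hw Hw').
  assert (P1 := Rmult_le_compat_l _ _ _ (Cmod_ge_0 (a (Datatypes.S n))) P).
  unfold b; lra.
Qed.

(** Complex power series may be differentiated termwise along a curve.
    Restricting to curves treats real and complex variables together. *)
Lemma Cpseries_Cder_curve a rho (g u : R -> C) z0 x g' d :
  radius_ge a rho -> Cder g x g' -> Cmod (g x - z0)%C < rho ->
  (forall y, Cmod (g y - z0)%C < rho -> is_Cpseries a (g y - z0)%C (u y)) ->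
  is_Cpseries (Cderive_coef a) (g x - z0)%C d ->
  Cder u x (g' * d)%C.
Proof.
intros Ha Hg Hx Hu Hd.
set (r := (Cmod (g x - z0)%C + rho) / 2).
assert (Hr : Cmod (g x - z0)%C < r < rho) by (unfold r; lra).
assert (Hr0 := Cmod_ge_0 (g x - z0)).
destruct (Cpseries_remainder_le a rho r Ha ltac:(lra)) as [K HK].
apply Cder_remainder with g K; auto.
destruct (Cder_Lipschitz g x g' Hg) as [L [HL0 [e HL]]].
assert (Hm : 0 < Rmin e ((r - Cmod (g x - z0)%C) / (L + 1))).
  apply Rmin_pos; [apply cond_pos|apply Rdiv_lt_0_compat; lra].
exists (mkposreal _ Hm); intros y Hy; change (Rabs (y - x) < Rmin e ((r - Cmod (g x - z0)%C) / (L + 1))) in Hy.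
assert (H1 : Rabs (y - x) < e) by (generalize (Rmin_l e ((r - Cmod (g x - z0)%C) / (L + 1))); lra).
assert (H2 : Rabs (y - x) < (r - Cmod (g x - z0)%C) / (L + 1))
  by (generalize (Rmin_r e ((r - Cmod (g x - z0)%C) / (L + 1))); lra).
apply Rlt_div_r in H2; [|lra].
assert (H3 := HL y H1).
assert (H4 : Cmod (g y - z0)%C <= r).
  replace (g y - z0)%C with ((g y - g x) + (g x - z0))%C by ring.
  eapply Rle_trans; [apply Cmod_triangle|].
  generalize (Rabs_pos (y - x)); nra.
replace (g y - g x)%C with ((g y - z0) - (g x - z0))%C by ring.
apply HK; auto; try apply Hu; lra.
Qed.

Lemma radius_ge_decr_1 a rho :
  radius_ge a rho -> radius_ge (fun n => a (S n)) rho.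
Proof.
unfold radius_ge; rewrite -(CV_radius_decr_1 (fun n => Cmod (a n))); auto.
Qed.

Lemma is_Cpseries_decr_1 a (w l : C) :
  w <> 0%C -> is_Cpseries a w l ->
  is_Cpseries (fun n => a (S n)) w (/ w * (l - a 0%nat))%C.
Proof.
intros Hw H.
exact (is_pseries_decr_1 (K := C_AbsRing) (V := C_NormedModule) a w (/ w)%C l
  (Cinv_l w Hw) H).
Qed.

(** The principle of isolated zeros. If the series vanishes at w <> 0, then a
    0 is w times a bounded quantity, so a 0 = 0 in the limit; dividing by w
    keeps the zeros and drops the first coefficient. *)
Lemma Cpseries_zeros a rho :
  0 < rho -> radius_ge a rho ->
  (forall eps, 0 < eps -> exists w : C, w <> 0%C /\ Cmod w < eps /\ is_Cpseries a w 0%C) ->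
  forall n, a n = 0%C.
Proof.
intros Hrho Ha Hz n; revert a Ha Hz.
assert (Step : forall a, radius_ge a rho ->
  (forall eps, 0 < eps -> exists w : C, w <> 0%C /\ Cmod w < eps /\ is_Cpseries a w 0%C) ->
  a 0%nat = 0%C).
  intros a Ha Hz.
  destruct (radius_ge_summable _ rho (rho / 2) (radius_ge_decr_1 a rho Ha) ltac:(lra))
    as [K HK].
  assert (Hb : forall w : C, w <> 0%C -> Cmod w < rho / 2 -> is_Cpseries a w 0%C ->
    Cmod (a 0%nat) <= Cmod w * K).
    intros w Hw0 Hw Hs; apply is_Cpseries_decr_1 in Hs; auto.
    assert (E : a 0%nat = (- w * (/ w * (0 - a 0%nat)))%C) by now field.
    rewrite E.
    rewrite Cmod_mult Cmod_opp; apply Rmult_le_compat_l; [apply Cmod_ge_0|].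
    apply is_Cpseries_series in Hs.
    refine (is_Cseries_Cmod_le _ _ _ _ Hs HK _).
    intros k; rewrite Cmod_mult Cmod_Cpow Rmult_comm.
    apply Rmult_le_compat_l; [apply Cmod_ge_0|].
    apply pow_incr; split; [apply Cmod_ge_0|lra].
  assert (HK0 : 0 <= Rabs K) by apply Rabs_pos.
  apply Cmod_eq_0, Rle_antisym; [|apply Cmod_ge_0].
  apply Rnot_lt_le; intros Hp.
  set (eps := Cmod (a 0%nat)) in *.
  assert (He : 0 < Rmin (rho / 2) (eps / (Rabs K + 1))).
    apply Rmin_pos; [lra|apply Rdiv_lt_0_compat; lra].
  destruct (Hz _ He) as [w [Hw0 [Hw Hs]]].
  assert (Hw1 := Rmin_l (rho / 2) (eps / (Rabs K + 1))).
  assert (Hw2 : Cmod w < eps / (Rabs K + 1))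
    by (generalize (Rmin_r (rho / 2) (eps / (Rabs K + 1))); lra).
  apply Rlt_div_r in Hw2; [|lra].
  specialize (Hb w Hw0 ltac:(lra) Hs).
  assert (P := Rmult_le_compat_l _ _ _ (Cmod_ge_0 w) (Rle_abs K)).
  generalize (Cmod_ge_0 w); lra.
induction n as [|n IH]; intros a Ha Hz; [auto|].
apply (IH (fun n => a (S n))); [now apply radius_ge_decr_1|].
intros eps Heps; destruct (Hz eps Heps) as [w [Hw0 [Hw Hs]]].
exists w; repeat split; auto.
apply is_Cpseries_decr_1 in Hs; auto; rewrite (Step a Ha Hz) in Hs.
now replace (/ w * (0 - 0))%C with (RtoC 0) in Hs by ring.
Qed.

(** * Continuation along exponential curves *)

(** The function u of the parameter is a power series in g - g t0 near the
    point g t0. Taking g to be the embedding of the real line gives real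
    analyticity; taking g t = x e^(ts) covers functions known only on that
    curve. *)
Definition germ (g u : R -> C) (t0 : R) (a : nat -> C) : Prop :=
  exists rho, 0 < rho /\ radius_ge a rho /\
    forall t, Cmod (g t - g t0)%C < rho -> is_Cpseries a (g t - g t0)%C (u t).

(** The operator z d/dz on power series in z - z0. *)
Definition theta_coef (z0 : C) (a : nat -> C) : nat -> C :=
  mulz_coef z0 (Cderive_coef a).

Lemma is_Cpseries_at_0 a : is_Cpseries a 0%C (a 0%nat).
Proof. exact (is_pseries_0 (K := C_AbsRing) (V := C_NormedModule) a). Qed.

Lemma germ_value g u t a : germ g u t a -> u t = a 0%nat.
Proof.
intros [rho [Hr [_ H]]].
assert (E : (g t - g t)%C = RtoC 0) by ring.
assert (H1 := H t); rewrite E Cmod_0 in H1; specialize (H1 Hr).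
assert (H2 : is_Cpseries a 0%C (a 0%nat)) by apply is_Cpseries_at_0.
rewrite is_Cpseries_series in H1; rewrite is_Cpseries_series in H2.
exact (is_series_C_unique _ _ _ H1 H2).
Qed.

(** The identity on v says that v is obtained from u by z d/dz, z = g t:
    termwise differentiation gives u' = g' * (du/dz). *)
Lemma germ_theta g dg u v t0 a :
  (forall t, Cder g t (dg t)) -> (forall t, dg t <> 0%C) ->
  (forall t, (dg t * v t)%C = (g t * CDerive u t)%C) ->
  germ g u t0 a ->
  germ g v t0 (theta_coef (g t0) a) /\ Cder u t0 (CDerive u t0).
Proof.
intros Hg Hg0 Hv [rho [Hr [Ha Hu]]].
assert (H : forall t, Cmod (g t - g t0)%C < rho ->
  exists d, is_Cpseries (Cderive_coef a) (g t - g t0)%C d /\ Cder u t (dg t * d)%C).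
  intros t Ht.
  destruct (radius_ge_converges _ rho (g t - g t0)%C (radius_ge_derive a rho Ha) Ht) as [d Hd].
  exists d; split; auto.
  apply (Cpseries_Cder_curve a rho g u (g t0)); auto.
split.
- exists rho; split; auto; split; [now apply radius_ge_mulz, radius_ge_derive|].
  intros t Ht; destruct (H t Ht) as [d [H1 H2]].
  replace (v t) with ((g t0 + (g t - g t0)) * d)%C.
    now apply is_Cpseries_mulz.
  assert (E := Hv t); rewrite (Cder_CDerive _ _ _ H2) in E.
  replace (v t) with (/ dg t * (dg t * v t))%C by (field; apply Hg0).
  rewrite E; field; apply Hg0.
- destruct (H t0) as [d [_ Hd]].
    replace (g t0 - g t0)%C with (RtoC 0) by ring; now rewrite Cmod_0.
  now rewrite (Cder_CDerive _ _ _ Hd).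
Qed.

Lemma germ_pow_mul g u t0 a n :
  germ g u t0 a ->
  germ g (fun t => g t ^ n * u t)%C t0 (Nat.iter n (mulz_coef (g t0)) a).
Proof.
intros [rho [Hr [Ha Hu]]]; exists rho; split; auto.
induction n as [|n [IH1 IH2]]; (split; [|intros t Ht]).
- exact Ha.
- replace (g t ^ 0 * u t)%C with (u t) by (simpl; ring); now apply Hu.
- now apply radius_ge_mulz.
- replace (g t ^ S n * u t)%C with ((g t0 + (g t - g t0)) * (g t ^ n * u t))%C
    by (simpl; ring).
  now apply is_Cpseries_mulz, IH2.
Qed.

Lemma is_Cpseries_minus a b z k l :
  is_Cpseries a z k -> is_Cpseries b z l ->
  is_Cpseries (fun n => a n - b n)%C z (k - l)%C.
Proof. apply: (is_pseries_minus (K := C_AbsRing) (V := C_NormedModule)). Qed.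

Lemma germ_minus g u v t0 a b :
  germ g u t0 a -> germ g v t0 b ->
  germ g (fun t => u t - v t)%C t0 (fun n => a n - b n)%C.
Proof.
intros [r1 [Hr1 [Ha Hu]]] [r2 [Hr2 [Hb Hv]]].
exists (Rmin r1 r2); split; [now apply Rmin_pos|].
assert (Q1 := Rmin_l r1 r2); assert (Q2 := Rmin_r r1 r2).
split; [|intros t Ht; apply is_Cpseries_minus; [apply Hu|apply Hv]; lra].
apply radius_ge_of_real; intros r Hr.
destruct (radius_ge_converges a r1 (RtoC r) Ha) as [k Hk].
  rewrite Cmod_R Rabs_pos_eq; lra.
destruct (radius_ge_converges b r2 (RtoC r) Hb) as [l Hl].
  rewrite Cmod_R Rabs_pos_eq; lra.
exists (k - l)%C; now apply is_Cpseries_minus.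
Qed.

Lemma germ_zeros g u t0 a :
  germ g u t0 a ->
  (forall eps, 0 < eps -> exists t, g t <> g t0 /\ Cmod (g t - g t0)%C < eps /\ u t = 0%C) ->
  forall n, a n = 0%C.
Proof.
intros [rho [Hr [Ha Hu]]] Hz; apply (Cpseries_zeros a rho Hr Ha).
intros eps Heps.
destruct (Hz (Rmin eps rho) (Rmin_pos _ _ Heps Hr)) as [t [H1 [H2 H3]]].
assert (Q1 := Rmin_l eps rho); assert (Q2 := Rmin_r eps rho).
exists (g t - g t0)%C; repeat split.
- intros E; apply H1.
  replace (g t) with ((g t - g t0) + g t0)%C by ring; rewrite E; ring.
- lra.
- rewrite -H3; apply Hu; lra.
Qed.

Lemma germ_zero g u t0 a :
  germ g u t0 a -> (forall n, a n = 0%C) ->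
  exists rho, 0 < rho /\ forall t, Cmod (g t - g t0)%C < rho -> u t = 0%C.
Proof.
intros [rho [Hr [_ Hu]]] Ha; exists rho; split; auto; intros t Ht.
assert (H1 := Hu t Ht); rewrite is_Cpseries_series in H1.
assert (H2 : is_Cpseries (fun _ => RtoC 0) (RtoC 0) (RtoC 0))
  by apply (is_Cpseries_at_0 (fun _ => RtoC 0)).
rewrite is_Cpseries_series in H2.
apply (is_series_C_unique _ _ _ H1).
eapply is_series_ext with (2 := H2); intros n; rewrite Ha; Cring.
Qed.

Lemma Cder_near g t0 d eps :
  Cder g t0 d -> 0 < eps ->
  exists delta, 0 < delta /\
    forall t, Rabs (t - t0) < delta -> Cmod (g t - g t0)%C < eps.
Proof.
intros Hg Heps; destruct (Cder_Lipschitz g t0 d Hg) as [L [HL0 [e HL]]].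
exists (Rmin e (eps / (L + 1))); split.
  apply Rmin_pos; [apply cond_pos|apply Rdiv_lt_0_compat; lra].
intros t Ht.
assert (Q1 := Rmin_l e (eps / (L + 1))); assert (Q2 := Rmin_r e (eps / (L + 1))).
assert (H1 : Rabs (t - t0) < eps / (L + 1)) by lra.
apply Rlt_div_r in H1; [|lra].
assert (H2 := HL t ltac:(change (Rabs (t - t0) < e); lra)).
generalize (Rabs_pos (t - t0)); lra.
Qed.

(** If g were constant to the left of t0, its derivative would vanish there.
    This supplies the accumulating points that [germ_zeros] asks for. *)
Lemma Cder_nonconstant_left g (dg : R -> C) t0 delta :
  (forall t, Cder g t (dg t)) -> (forall t, dg t <> 0%C) -> 0 < delta ->
  exists t, t0 - delta < t < t0 /\ g t <> g t0.
Proof.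
intros Hg Hg0 Hd; apply NNPP; intros Hn.
assert (H : forall t, t0 - delta < t < t0 -> g t = g t0).
  intros t Ht; apply NNPP; intros E; apply Hn; now exists t.
apply (Hg0 (t0 - delta / 2)).
rewrite -(Cder_CDerive _ _ _ (Hg (t0 - delta / 2))).
apply Cder_CDerive.
apply (Cder_ext_loc (fun _ => g t0)); [|apply Cder_const].
assert (Hp : 0 < delta / 2) by lra.
exists (mkposreal _ Hp); intros t Ht.
change (Rabs (t - (t0 - delta / 2)) < delta / 2) in Ht.
symmetry; apply H; apply Rabs_lt_between in Ht; lra.
Qed.

(** The identity theorem along a curve. Let s be the supremum of the
    parameters up to which u vanishes. If s > 0, zeros accumulate at s from
    the left, so the germ at s is zero, as it is by hypothesis for s = 0. Then
    u vanishes on both sides of s, which forces s = 1. *)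
Lemma germ_propagation g dg u a :
  (forall t, Cder g t (dg t)) -> (forall t, dg t <> 0%C) ->
  (forall t, 0 <= t <= 1 -> exists b, germ g u t b) ->
  germ g u 0 a -> (forall n, a n = 0%C) ->
  forall t, 0 <= t <= 1 -> u t = 0%C.
Proof.
intros Hg Hg0 Hu Ha Ha0.
set (E := fun t => 0 <= t <= 1 /\ forall t', 0 <= t' <= t -> u t' = 0%C).
assert (HE0 : E 0).
  split; [lra|]; intros t' Ht'; replace t' with 0 by lra.
  now rewrite (germ_value _ _ _ _ Ha).
destruct (completeness E) as [s [Hs1 Hs2]].
  exists 1; intros t [Ht _]; lra.
  now exists 0.
assert (Hs : 0 <= s <= 1).
  split; [now apply Hs1|]; apply Hs2; intros t [Ht _]; lra.
assert (Hleft : forall t, 0 <= t < s -> u t = 0%C).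
  intros t Ht; apply NNPP; intros Hn.
  assert (s <= t); [|lra].
  apply Hs2; intros t' [_ Ht'].
  apply Rnot_lt_le; intros Hlt; apply Hn, Ht'; lra.
assert (Hnear : exists delta, 0 < delta /\ forall t, Rabs (t - s) < delta -> u t = 0%C).
  assert (Hrho : exists rho, 0 < rho /\ forall t, Cmod (g t - g s)%C < rho -> u t = 0%C).
    destruct (Req_dec s 0) as [Es|Es].
      rewrite Es; apply (germ_zero g u 0 a Ha Ha0).
    destruct (Hu s Hs) as [b Hb].
    apply (germ_zero g u s b Hb), (germ_zeros g u s b Hb).
    intros eps Heps.
    destruct (Cder_near g s _ eps (Hg s) Heps) as [d [Hd1 Hd2]].
    destruct (Cder_nonconstant_left g dg s (Rmin d s) Hg Hg0) as [t [Ht1 Ht2]].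
      apply Rmin_pos; lra.
    assert (Q1 := Rmin_l d s); assert (Q2 := Rmin_r d s).
    exists t; repeat split; auto.
      apply Hd2; rewrite Rabs_left; lra.
    apply Hleft; lra.
  destruct Hrho as [rho [Hr1 Hr2]].
  destruct (Cder_near g s _ rho (Hg s) Hr1) as [d [Hd1 Hd2]].
  exists d; split; auto.
destruct Hnear as [d [Hd1 Hd2]].
assert (HE : E (Rmin 1 (s + d / 2))).
  assert (Q1 := Rmin_l 1 (s + d / 2)); assert (Q2 := Rmin_r 1 (s + d / 2)).
  split; [split; auto; apply Rmin_glb; lra|].
  intros t' Ht'; destruct (Rlt_le_dec t' s) as [Hlt|Hle].
    apply Hleft; lra.
  apply Hd2; rewrite Rabs_pos_eq; lra.
assert (P := Hs1 _ HE).
assert (E1 : Rmin 1 (s + d / 2) = 1).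
  unfold Rmin in *; destruct (Rle_dec 1 (s + d / 2)); lra.
rewrite E1 in HE; intros t Ht; apply HE; lra.
Qed.

Lemma RtoC_Cder x : Cder RtoC x 1%C.
Proof. apply (Cder_RtoC (fun y => y)); apply: is_derive_id. Qed.

Lemma RtoC_1_neq0 : RtoC 1 <> RtoC 0.
Proof. apply RtoC_neq0; lra. Qed.

Lemma germ_iter_xD u x a n :
  germ RtoC u x a -> germ RtoC (Nat.iter n xD u) x (Nat.iter n (theta_coef (RtoC x)) a).
Proof.
intros H; induction n as [|n IH]; auto.
apply (germ_theta RtoC (fun _ => RtoC 1) (Nat.iter n xD u)); auto using RtoC_Cder, RtoC_1_neq0.
intros t; simpl; unfold xD at 1; ring.
Qed.

Lemma carrier_theta_values m U f x a n :
  (1 <= m)%nat -> carrier_system m U f -> U x -> germ RtoC (f 0%nat) x a ->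
  Nat.iter n (theta_coef (RtoC x)) a 0%nat = stirling_sum m f n x.
Proof.
intros Hm Hf Hx Ha.
rewrite -(germ_value _ _ _ _ (germ_iter_xD _ _ _ n Ha)).
now apply (iter_xD_stirling_sum m U).
Qed.

(** (xD)^m f_0 = x^m f_0 holds at all real points near x, which is enough to
    identify the two coefficient sequences. *)
Lemma carrier_theta_ode m U f x a n :
  (1 <= m)%nat -> carrier_system m U f -> U x -> germ RtoC (f 0%nat) x a ->
  Nat.iter m (theta_coef (RtoC x)) a n = Nat.iter m (mulz_coef (RtoC x)) a n.
Proof.
intros Hm Hf Hx Ha.
assert (H := germ_minus _ _ _ _ _ _ (germ_iter_xD _ _ _ m Ha) (germ_pow_mul _ _ _ _ m Ha)).
assert (P := germ_zeros _ _ _ _ H).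
assert (Q : forall k : nat, (Nat.iter m (theta_coef (RtoC x)) a k -
  Nat.iter m (mulz_coef (RtoC x)) a k)%C = 0%C).
  apply P; intros eps Heps.
  destruct (proj1 Hf x Hx) as [d Hd].
  assert (Hm0 : 0 < Rmin d eps) by (apply Rmin_pos; auto; apply cond_pos).
  assert (Q1 := Rmin_l d eps); assert (Q2 := Rmin_r d eps).
  exists (x + Rmin d eps / 2).
  assert (HU : U (x + Rmin d eps / 2)).
    apply Hd; change (Rabs (x + Rmin d eps / 2 - x) < d).
    rewrite Rabs_pos_eq; lra.
  repeat split.
  - intros E; injection E; lra.
  - rewrite -RtoC_minus Cmod_R Rabs_pos_eq; lra.
  - rewrite (iter_xD_stirling_sum m U) // stirling_sum_low //.
    rewrite Nat.Div0.mod_same RtoC_Cpow; ring.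
specialize (Q n).
replace (Nat.iter m (theta_coef (RtoC x)) a n) with
  ((Nat.iter m (theta_coef (RtoC x)) a n - Nat.iter m (mulz_coef (RtoC x)) a n)
   + Nat.iter m (mulz_coef (RtoC x)) a n)%C by ring.
rewrite Q; ring.
Qed.

Lemma Cexp_Cder (s : C) t : Cder (fun t => Cexp (RtoC t * s)) t (s * Cexp (RtoC t * s))%C.
Proof.
destruct s as [p q]; unfold Cexp; split; simpl; auto_derive; auto; unfold Rminus; ring.
Qed.

Lemma Cexp_neq0 z : Cexp z <> 0%C.
Proof.
unfold Cexp; intros E; injection E; intros E2 E1.
assert (P := sin2_cos2 (Im z)); assert (Q := exp_pos (Re z)); unfold Rsqr in P.
apply Rmult_integral in E1; apply Rmult_integral in E2.
destruct E1 as [E1|E1]; [lra|]; destruct E2 as [E2|E2]; [lra|].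
rewrite E1 E2 in P; lra.
Qed.

Lemma Cder_pow_exp g s t p :
  Cder g t (s * g t)%C ->
  Cder (fun y => g y ^ p)%C t (RtoC (INR p) * s * g t ^ p)%C.
Proof.
intros H; destruct p as [|p].
  replace (RtoC (INR 0) * s * g t ^ 0)%C with (RtoC 0) by (simpl; ring).
  apply (Cder_const 1%C).
evar_last; [apply (Cder_pow g t _ p H)|]; simpl Cpow; ring.
Qed.

Lemma div_mod_S m k :
  (1 <= m)%nat ->
  (S (k mod m) = m /\ (S k / m = S (k / m))%nat /\ (S k mod m = 0)%nat) \/
  (S (k mod m) < m /\ S k / m = k / m /\ S k mod m = S (k mod m))%nat.
Proof.
intros Hm.
assert (H1 := Nat.div_mod_eq k m); assert (H2 := Nat.mod_upper_bound k m ltac:(lia)).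
destruct (Nat.eq_dec (S (k mod m)) m) as [E|E]; [left|right]; (split; [lia|]).
- split; symmetry.
  + apply Nat.div_unique with 0%nat; lia.
  + apply Nat.mod_unique with (S (k / m)); lia.
- split; symmetry.
  + apply Nat.div_unique with (S (k mod m)); lia.
  + apply Nat.mod_unique with (k / m)%nat; lia.
Qed.

(** The function h is f_0, or an analytic extension of it, along x e^(ts). The
    functions u n = (xD)^n h satisfy u m = z^m u 0 near the base point, hence
    along the whole curve, so that z^(m (k / m)) u (k mod m) is a Stirling
    ladder there. *)
Lemma carrier_continuation m U f x (s : C) h a :
  (1 <= m)%nat -> carrier_system m U f -> U x -> s <> 0%C ->
  germ RtoC (f 0%nat) x a ->
  germ (fun t => RtoC x * Cexp (RtoC t * s))%C h 0 a ->
  (forall t, 0 <= t <= 1 -> exists b, germ (fun t => RtoC x * Cexp (RtoC t * s))%C h t b) ->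
  is_Cpseries (stirling_series m f x) s (h 1).
Proof.
intros Hm Hf Hx Hs Hax.
set (g := fun t => (RtoC x * Cexp (RtoC t * s))%C); intros Hah Hh.
assert (Hx0 : 0 < x) by (apply Hf; auto).
assert (Eg0 : g 0 = RtoC x).
  unfold g; replace (RtoC 0 * s)%C with (RtoC 0) by ring.
  unfold Cexp; simpl; rewrite exp_0 cos_0 sin_0.
  apply injective_projections; simpl; ring.
assert (Hg : forall t, Cder g t (s * g t)%C).
  intros t; unfold g; evar_last; [apply Cder_scal, Cexp_Cder|ring].
assert (Hgn : forall t, g t <> 0%C).
  intros t; apply Cmult_neq_0; [apply RtoC_neq0; lra|apply Cexp_neq0].
assert (Hg0 : forall t, (s * g t)%C <> 0%C) by (intros t; apply Cmult_neq_0; auto).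
set (u := fun n => Nat.iter n (fun u t => CDerive u t / s)%C h).
assert (Hu : forall n t b, germ g h t b ->
  germ g (u n) t (Nat.iter n (theta_coef (g t)) b) /\ Cder (u n) t (s * u (S n) t)%C).
  intros n t b Hb.
  assert (Hn : germ g (u n) t (Nat.iter n (theta_coef (g t)) b)).
    induction n as [|n IH]; auto.
    apply (germ_theta g (fun t => s * g t)%C (u n)); auto.
    intros y; simpl; unfold Cdiv; field; auto.
  split; auto.
  replace (s * u (S n) t)%C with (CDerive (u n) t) by (simpl; field; auto).
  apply (germ_theta g (fun t => s * g t)%C (u n) (u (S n)) t _ Hg Hg0) with (2 := Hn).
  intros y; simpl; field; auto.
assert (Hud : forall n t, 0 <= t <= 1 -> Cder (u n) t (s * u (S n) t)%C).
  intros n t Ht; destruct (Hh t Ht) as [b Hb]; now apply (Hu n t b).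
assert (Hu0 : forall n, u n 0 = stirling_sum m f n x).
  intros n; destruct (Hu n 0 a Hah) as [H _].
  rewrite (germ_value _ _ _ _ H) Eg0; now apply (carrier_theta_values m U).
assert (Hode : forall t, 0 <= t <= 1 -> u m t = (g t ^ m * u 0%nat t)%C).
  intros t Ht.
  assert (Z : (u m t - g t ^ m * u 0%nat t)%C = 0%C).
    revert t Ht.
    assert (G : forall t b, germ g h t b -> germ g (fun t => u m t - g t ^ m * u 0%nat t)%C t
      (fun n => Nat.iter m (theta_coef (g t)) b n - Nat.iter m (mulz_coef (g t)) b n)%C).
      intros t b Hb; apply (germ_minus g (u m) (fun t => g t ^ m * u 0%nat t)%C).
        now apply Hu.
      now apply (germ_pow_mul g (u 0%nat)).
    apply (germ_propagation g (fun t => s * g t)%C _ _ Hg Hg0) with (2 := G 0 a Hah).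
    - intros t Ht; destruct (Hh t Ht) as [b Hb]; eexists; apply (G t b Hb).
    - intros n; rewrite Eg0 (carrier_theta_ode m U f) //; ring.
  replace (u m t) with ((u m t - g t ^ m * u 0%nat t) + g t ^ m * u 0%nat t)%C by ring.
  rewrite Z; ring.
destruct (finite_bound u (fun t => 0 <= t <= 1) m) as [M [HM HB]].
  intros r _; apply (Cder_bounded _ (fun t => s * u (S r) t)%C); auto.
destruct (Cder_bounded g (fun t => s * g t)%C) as [X0 HX0]; [auto|].
set (X := Rmax 1 X0).
assert (HX1 : 1 <= X) by apply Rmax_l.
assert (HX : forall t, 0 <= t <= 1 -> Cmod (g t) <= X).
  intros t Ht; eapply Rle_trans; [apply HX0; auto|apply Rmax_r].
set (P := fun k t => (g t ^ (m * (k / m)) * u (k mod m)%nat t)%C).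
evar_last.
  eapply is_pseries_ext; [|apply (stirling_taylor m s P M X)]; auto; try lra.
- intros n; unfold stirling_series; f_equal; apply sum_n_ext; intros k.
  assert (Hk := Nat.mod_upper_bound k m ltac:(lia)).
  unfold P; rewrite Hu0 Eg0 stirling_sum_low; [|lia].
  rewrite -RtoC_Cpow (Nat.mod_small (k mod m) m) //.
  rewrite -Cmult_assoc; apply f_equal.
  rewrite Cmult_assoc -RtoC_mult -pow_add -Nat.div_mod_eq //.
- intros k t Ht.
  (* At the end of a block of length m, the equation u m = g^m u 0 leads to
     the next block. *)
  assert (E : (g t ^ (m * (k / m)) * u (S (k mod m)) t)%C = P (S k) t).
    unfold P; destruct (div_mod_S m k Hm) as [[E1 [E2 E3]]|[E1 [E2 E3]]].
      rewrite E1 E2 E3 Hode // Cmult_assoc -Cpow_add_r.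
      do 2 f_equal; lia.
    now rewrite E2 E3.
  rewrite -E; unfold P.
  evar_last.
    apply Cder_mult; [apply Cder_pow_exp, Hg|apply Hud; auto].
  cbv beta; ring.
- intros k t Ht; unfold P; rewrite Cmod_mult Cmod_Cpow Rmult_comm.
  apply Rmult_le_compat; auto using Cmod_ge_0.
  + apply pow_le, Cmod_ge_0.
  + apply HB; auto; apply Nat.mod_upper_bound; lia.
  + apply Rle_trans with (X ^ (m * (k / m))).
      apply pow_incr; auto using Cmod_ge_0.
    apply Rle_pow; auto; apply Nat.Div0.mul_div_le.
- unfold P; rewrite Nat.Div0.div_0_l Nat.Div0.mod_0_l Nat.mul_0_r; simpl; ring.
Qed.

Lemma stirling_series_0 m f x : stirling_series m f x 0%nat = f 0%nat x.
Proof.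
unfold stirling_series; rewrite stirling_sum_low; [|lia].
rewrite Nat.Div0.mod_0_l; simpl; rewrite Rinv_1; ring.
Qed.

Lemma RtoC_Cexp x r : RtoC (x * exp r) = (RtoC x * Cexp (RtoC r))%C.
Proof.
unfold Cexp; simpl; rewrite cos_0 sin_0.
apply injective_projections; simpl; ring.
Qed.

(** Along the curve x e^(ts) with real s, differences of points are real, so
    the real power series of f_0 are germs on the curve. *)
Lemma analytic_expansion_real m U f x t (W : R -> Prop) :
  (1 <= m)%nat -> carrier_system m U f -> U x ->
  (forall s, Rabs s <= Rabs t -> W (x * exp s)) ->
  (forall y, W y -> analytic_at (f 0%nat) y) ->
  forall s, Rabs s <= Rabs t ->
    is_Cpseries (stirling_series m f x) (RtoC s) (f 0%nat (x * exp s)).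
Proof.
intros Hm Hf Hx HW HA s Hs.
destruct (Req_dec s 0) as [->|Hs0].
  rewrite exp_0 Rmult_1_r -(stirling_series_0 m f x); apply is_Cpseries_at_0.
assert (G : forall y, W y -> exists b rho, 0 < rho /\ radius_ge b rho /\
  forall z, Rabs (z - y) < rho -> is_Cpseries b (RtoC (z - y)) (f 0%nat z)).
  intros y Hy; destruct (HA y Hy) as [b [rho [Hr Hb]]].
  exists b, rho; split; auto; split; auto.
  apply radius_ge_of_real; intros r Hrr; exists (f 0%nat (y + r)).
  replace r with (y + r - y) at 1 by ring; apply Hb.
  replace (y + r - y) with r by ring; rewrite Rabs_pos_eq; lra.
assert (Hcurve : forall t0 b rho, 0 < rho -> radius_ge b rho ->
  (forall z, Rabs (z - x * exp (t0 * s)) < rho ->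
     is_Cpseries b (RtoC (z - x * exp (t0 * s))) (f 0%nat z)) ->
  germ (fun t => RtoC x * Cexp (RtoC t * RtoC s))%C (fun t => f 0%nat (x * exp (t * s))) t0 b).
  intros t0 b rho Hr Hb H; exists rho; split; auto; split; auto.
  intros t1; rewrite -!RtoC_mult -!RtoC_Cexp -RtoC_minus Cmod_R; apply H.
assert (H0 : x * exp (0 * s) = x) by (rewrite Rmult_0_l exp_0; ring).
assert (Wx : W x).
  rewrite -H0; apply HW; rewrite Rmult_0_l Rabs_R0; apply Rabs_pos.
destruct (G x Wx) as [a [rho [Hr [Ha1 Ha2]]]].
evar_last.
  apply (carrier_continuation m U f x (RtoC s) (fun t => f 0%nat (x * exp (t * s))) a); auto.
- now apply RtoC_neq0.
- exists rho; split; auto; split; auto; intros z.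
  rewrite -RtoC_minus Cmod_R; apply Ha2.
- apply (Hcurve 0 a rho); auto; now rewrite H0.
- intros t0 Ht0; destruct (G (x * exp (t0 * s))) as [b [r [H1 [H2 H3]]]].
    apply HW; rewrite Rabs_mult Rabs_pos_eq; [|lra].
    generalize (Rabs_pos s); nra.
  exists b; now apply (Hcurve t0 b r).
- now rewrite Rmult_1_l.
Qed.

Lemma analytic_expansion_complex m U f x (t : C) (W : C -> Prop) (g : C -> C) :
  (1 <= m)%nat -> carrier_system m U f -> U x ->
  (forall s : C, Cmod s <= Cmod t -> W (RtoC x * Cexp s)%C) ->
  (forall z : C, W z -> Canalytic_at g z) ->
  locally x (fun y : R => g (RtoC y) = f 0%nat y) ->
  forall s : C, Cmod s <= Cmod t ->
    is_Cpseries (stirling_series m f x) s (g (RtoC x * Cexp s)%C).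
Proof.
intros Hm Hf Hx HW HA Hloc s Hs.
assert (E0 : (RtoC x * Cexp (RtoC 0))%C = RtoC x).
  rewrite -RtoC_Cexp exp_0; f_equal; ring.
destruct (Ceq_dec s 0%C) as [->|Hs0].
  rewrite E0 (locally_singleton _ _ Hloc) -(stirling_series_0 m f x); apply is_Cpseries_at_0.
assert (G : forall y : C, W y -> exists b rho, 0 < rho /\ radius_ge b rho /\
  forall z : C, Cmod (z - y)%C < rho -> is_Cpseries b (z - y)%C (g z)).
  intros y Hy; destruct (HA y Hy) as [b [rho [Hr Hb]]].
  exists b, rho; split; auto; split; auto.
  apply radius_ge_of_real; intros r Hrr; exists (g (y + RtoC r)%C).
  replace (RtoC r) with (y + RtoC r - y)%C at 1 by ring; apply Hb.
  replace (y + RtoC r - y)%C with (RtoC r) by ring; rewrite Cmod_R Rabs_pos_eq; lra.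
assert (Wx : W (RtoC x)).
  rewrite -E0; apply HW; rewrite Cmod_0; apply Cmod_ge_0.
destruct (G _ Wx) as [a [rho [Hr [Ha1 Ha2]]]].
assert (H0 : (RtoC x * Cexp (RtoC 0 * s))%C = RtoC x) by (rewrite -{2}E0; do 2 f_equal; ring).
evar_last.
  apply (carrier_continuation m U f x s (fun t => g (RtoC x * Cexp (RtoC t * s))%C) a); auto.
- destruct Hloc as [d Hd].
  assert (Q1 := Rmin_l d rho); assert (Q2 := Rmin_r d rho).
  exists (Rmin d rho); split; [apply Rmin_pos; auto; apply cond_pos|].
  split; [eapply Rbar_le_trans; [|apply Ha1]; exact Q2|].
  intros z Hz; rewrite -Hd; [apply Ha2; lra|].
  rewrite -RtoC_minus Cmod_R in Hz; change (Rabs (z - x) < d); lra.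
- exists rho; split; auto; split; auto; intros z; rewrite H0; apply Ha2.
- intros t0 Ht0; destruct (G (RtoC x * Cexp (RtoC t0 * s))%C) as [b [r [H1 [H2 H3]]]].
    apply HW; rewrite Cmod_mult Cmod_R Rabs_pos_eq; [|lra].
    generalize (Cmod_ge_0 s); nra.
  exists b, r; split; auto.
- now rewrite Cmult_1_l.
Qed.

(** * The functions K_0 and K_1 *)

Lemma carrier_of_real m (F : nat -> R -> R) :
  (forall r x, (r < m)%nat -> 0 < x -> exists l,
     is_derive (F r) x l /\ x * l + INR r * F r x = x * F (Nat.modulo (r + 1) m) x) ->
  carrier_system m (fun x => 0 < x) (fun r x => RtoC (F r x)).
Proof.
intros H; split; [apply open_gt|]; split; auto.
intros r Hr x Hx; destruct (H r x Hr Hx) as [l [Hl E]].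
assert (Hc := Cder_RtoC _ _ _ Hl); split.
  apply (Cder_differentiable _ _ _ Hc).
unfold xD; rewrite (Cder_CDerive _ _ _ Hc) -!RtoC_mult -RtoC_plus; now f_equal.
Qed.

(** The integrals over [0, b] increase with b and stay below K, so they
    converge to their supremum. *)
Lemma improper_integral_exists (f : R -> R) K :
  (forall t, continuous f t) ->
  (forall t, 0 <= t -> 0 <= f t <= K * exp (- t)) ->
  exists l, is_RInt_gen f (at_point 0) (Rbar_locally p_infty) l.
Proof.
intros Hc Hb.
assert (Hi : forall a b, ex_RInt f a b).
  intros a b; apply (ex_RInt_continuous f); auto.
assert (HK : 0 <= K).
  assert (P := Hb 0 (Rle_refl 0)); rewrite Ropp_0 exp_0 in P; lra.
assert (Hle : forall b, 0 <= b -> RInt f 0 b <= K).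
  intros b Hb0.
  assert (Hg : is_RInt (fun t => K * exp (- t)) 0 b (- K * exp (- b) - - K * exp (- 0))).
    apply: (is_RInt_derive (fun t => - K * exp (- t))).
    - intros t _; auto_derive; auto; ring.
    - intros t _; apply: ex_derive_continuous; auto_derive; auto.
  apply Rle_trans with (- K * exp (- b) - - K * exp (- 0)).
    rewrite -(is_RInt_unique _ _ _ _ Hg).
    apply RInt_le; auto; [now eexists; apply Hg|].
    intros t Ht; apply Hb; lra.
  rewrite Ropp_0 exp_0; assert (P := exp_pos (- b)); nra.
assert (Hincr : forall a b, 0 <= a <= b -> RInt f 0 a <= RInt f 0 b).
  intros a b Hab.
  rewrite -(RInt_Chasles f 0 a b) //.
  assert (0 <= RInt f a b).
    apply RInt_ge_0; auto; [lra|]; intros t Ht; apply Hb; lra.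
  unfold plus; simpl; lra.
destruct (completeness (fun y => exists b, 0 <= b /\ y = RInt f 0 b)) as [l [Hl1 Hl2]].
- exists K; intros y [b [Hb0 ->]]; auto.
- exists (RInt f 0 0), 0; split; auto; lra.
- exists l; intros P [eps HP].
  assert (Hex : exists b0, 0 <= b0 /\ l - eps < RInt f 0 b0).
    destruct (classic (exists b0, 0 <= b0 /\ l - eps < RInt f 0 b0)) as [H|H]; auto.
    assert (l <= l - eps).
      apply Hl2; intros y [b [Hb0 ->]]; apply Rnot_lt_le; intros Hlt; apply H; now exists b.
    generalize (cond_pos eps); lra.
  destruct Hex as [b0 [Hb0 Hlt]].
  exists (fun a => a = 0) (fun b => b0 < b).
  + reflexivity.
  + now exists b0.
  + intros a b -> Hbb; exists (RInt f 0 b); split.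
      apply: RInt_correct; auto.
    apply HP; change (Rabs (RInt f 0 b - l) < eps).
    assert (RInt f 0 b <= l) by (apply Hl1; exists b; split; auto; lra).
    assert (RInt f 0 b0 <= RInt f 0 b) by (apply Hincr; lra).
    rewrite Rabs_left1; lra.
Qed.

Definition cosh_kernel (p : nat) (x t : R) : R := cosh t ^ p * exp (- x * cosh t).

(** besselK 0 and besselK 1 are the moments of order 0 and 1, and
    differentiation in x raises the order by one, up to sign. *)
Definition cosh_moment (p : nat) (x : R) : R :=
  RInt_gen (cosh_kernel p x) (at_point 0) (Rbar_locally p_infty).

Lemma cosh_exp_le t : exp t / 2 <= cosh t.
Proof. unfold cosh; generalize (exp_pos (- t)); lra. Qed.

Lemma cosh_pos t : 0 < cosh t.
Proof. eapply Rlt_le_trans; [|apply cosh_exp_le]; generalize (exp_pos t); lra. Qed.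

Lemma cosh_kernel_ge0 p x t : 0 <= cosh_kernel p x t.
Proof.
apply Rmult_le_pos; [apply pow_le; left; apply cosh_pos|left; apply exp_pos].
Qed.

(** From y^(p+1) / (p+1)! <= e^y at y = x cosh t, together with 1 / cosh t <=
    2 e^-t. *)
Lemma cosh_kernel_le p x t :
  0 < x ->
  cosh_kernel p x t <= 2 * INR (fact (S p)) / x ^ S p * exp (- t).
Proof.
intros Hx; assert (Hc := cosh_pos t).
assert (Hf := INR_fact_lt_0 (S p)).
assert (Hxp : 0 < x ^ S p) by now apply pow_lt.
assert (Het := exp_pos t).
assert (H1 : (x * cosh t) ^ S p <= exp (x * cosh t) * INR (fact (S p))).
  apply Rle_div_l; auto; apply pow_div_fact_le_exp.
  apply Rmult_le_pos; lra.
assert (H2 : exp (x * cosh t) * exp (- x * cosh t) = 1).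
  rewrite -exp_plus; replace (x * cosh t + - x * cosh t) with 0 by ring; apply exp_0.
assert (H3 : exp t * exp (- t) = 1).
  rewrite -exp_plus; replace (t + - t) with 0 by ring; apply exp_0.
apply Rmult_le_reg_r with (cosh t * x ^ S p); [now apply Rmult_lt_0_compat|].
apply Rle_trans with (INR (fact (S p))).
  replace (cosh_kernel p x t * (cosh t * x ^ S p)) with
    ((x * cosh t) ^ S p * exp (- x * cosh t))
    by (unfold cosh_kernel; rewrite Rpow_mult_distr; simpl; ring).
  assert (P := Rmult_le_compat_r _ _ _ (Rlt_le _ _ (exp_pos (- x * cosh t))) H1).
  eapply Rle_trans; [apply P|].
  right; transitivity ((exp (x * cosh t) * exp (- x * cosh t)) * INR (fact (S p))); [ring|].
  rewrite H2; ring.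
replace (2 * INR (fact (S p)) / x ^ S p * exp (- t) * (cosh t * x ^ S p))
  with (INR (fact (S p)) * (2 * exp (- t) * cosh t)) by (field; lra).
rewrite -{1}(Rmult_1_r (INR (fact (S p)))); apply Rmult_le_compat_l; [lra|].
rewrite -H3.
assert (P := Rmult_le_compat_r _ _ _ (Rlt_le _ _ (exp_pos (- t))) (cosh_exp_le t)); lra.
Qed.

Lemma cosh_derive t : is_derive cosh t (sinh t).
Proof. apply is_derive_Reals, derivable_pt_lim_cosh. Qed.

Lemma cosh_kernel_continuous p x t : continuous (cosh_kernel p x) t.
Proof.
apply: ex_derive_continuous; unfold cosh_kernel.
auto_derive; auto.
Qed.

Lemma cosh_moment_correct p x :
  0 < x ->
  is_RInt_gen (cosh_kernel p x) (at_point 0) (Rbar_locally p_infty) (cosh_moment p x).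
Proof.
intros Hx.
destruct (improper_integral_exists (cosh_kernel p x) (2 * INR (fact (S p)) / x ^ S p))
  as [l Hl]; [| |unfold cosh_moment; now rewrite (is_RInt_gen_unique _ _ Hl)].
- intros t; apply cosh_kernel_continuous.
- intros t _; split; [apply cosh_kernel_ge0|now apply cosh_kernel_le].
Qed.

(** Both e^u and e^-u lie above their tangents at 0, whence 0 <= e^u - 1 - u
    <= u (e^u - 1). *)
Lemma exp_remainder_le u : Rabs (exp u - 1 - u) <= u ^ 2 * exp (Rabs u).
Proof.
assert (H1 := exp_ineq1_le u); assert (H2 := exp_ineq1_le (- u)).
assert (H3 : exp u * exp (- u) = 1).
  rewrite -exp_plus; replace (u + - u) with 0 by ring; apply exp_0.
assert (Hp := exp_pos u).
rewrite Rabs_pos_eq; [|lra].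
assert (H4 : exp u - 1 <= u * exp u) by nra.
destruct (Rle_lt_dec 0 u) as [Hu|Hu].
  rewrite Rabs_pos_eq; auto; nra.
assert (H5 := exp_ineq1_le (Rabs u)); rewrite Rabs_left // in H5 |- *; nra.
Qed.

Lemma cosh_kernel_remainder_le p x y t :
  0 < x -> Rabs (y - x) <= x / 2 ->
  Rabs (cosh_kernel p y t - cosh_kernel p x t + (y - x) * cosh_kernel (S p) x t)
  <= (y - x) ^ 2 * cosh_kernel (S (S p)) (x / 2) t.
Proof.
intros Hx Hy; assert (Hc := cosh_pos t); unfold cosh_kernel.
set (u := - (y - x) * cosh t).
replace (- y * cosh t) with (- x * cosh t + u) by (unfold u; ring).
rewrite exp_plus.
replace (cosh t ^ p * (exp (- x * cosh t) * exp u) - cosh t ^ p * exp (- x * cosh t)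
  + (y - x) * (cosh t ^ S p * exp (- x * cosh t)))
  with (cosh t ^ p * exp (- x * cosh t) * (exp u - 1 - u)) by (unfold u; simpl; ring).
assert (Hcp : 0 <= cosh t ^ p) by (apply pow_le; lra).
assert (He := exp_pos (- x * cosh t)).
rewrite Rabs_mult Rabs_pos_eq; [|apply Rmult_le_pos; lra].
eapply Rle_trans.
  apply Rmult_le_compat_l; [apply Rmult_le_pos; lra|apply exp_remainder_le].
replace (cosh t ^ p * exp (- x * cosh t) * (u ^ 2 * exp (Rabs u)))
  with ((y - x) ^ 2 * cosh t ^ S (S p) * (exp (- x * cosh t) * exp (Rabs u)))
  by (unfold u; simpl; ring).
rewrite -exp_plus -Rmult_assoc; apply Rmult_le_compat_l.
  apply Rmult_le_pos; [apply pow2_ge_0|apply pow_le; lra].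
assert (Hu : Rabs u <= x / 2 * cosh t).
  unfold u; rewrite Rabs_mult Rabs_Ropp (Rabs_pos_eq (cosh t)); [|lra].
  apply Rmult_le_compat_r; lra.
destruct (Rle_lt_or_eq_dec (- x * cosh t + Rabs u) (- (x / 2) * cosh t)) as [H|H].
- lra.
- left; now apply exp_increasing.
- rewrite H; lra.
Qed.

Lemma at_point_0_infty_le (Q : R * R -> Prop) :
  (forall b, 0 <= b -> Q (0, b)) ->
  filter_prod (at_point 0) (Rbar_locally p_infty) Q.
Proof.
intros H; exists (fun a => a = 0) (fun b => 0 < b).
- reflexivity.
- now exists 0.
- intros a b -> Hb; apply H; lra.
Qed.

(** Differentiation under the integral sign: for |y - x| < x/2 the remainder
    of the integrand is at most (y - x)^2 times a kernel that is integrable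
    and does not depend on y. *)
Lemma cosh_moment_derive p x :
  0 < x -> is_derive (cosh_moment p) x (- cosh_moment (S p) x).
Proof.
intros Hx.
set (v := fun y => cosh_moment p y - cosh_moment p x + (y - x) * cosh_moment (S p) x).
assert (Hv : is_derive v x 0).
  apply is_derive_quadratic with (cosh_moment (S (S p)) (x / 2)).
  assert (Hx2 : 0 < x / 2) by lra.
  exists (mkposreal _ Hx2); intros y Hy; change (Rabs (y - x) < x / 2) in Hy.
  assert (Hy0 : 0 < y) by (apply Rabs_lt_between in Hy; lra).
  rewrite Rmult_comm.
  refine (RInt_gen_norm (V := R_CompleteNormedModule) (Fa := at_point 0)
    (Fb := Rbar_locally p_infty)
    (fun t => cosh_kernel p y t - cosh_kernel p x t + (y - x) * cosh_kernel (S p) x t)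
    (fun t => (y - x) ^ 2 * cosh_kernel (S (S p)) (x / 2) t) _ _ _ _ _ _).
  - apply at_point_0_infty_le; auto.
  - apply at_point_0_infty_le; intros b _ t _.
    apply cosh_kernel_remainder_le; lra.
  - apply: is_RInt_gen_plus; [apply: is_RInt_gen_minus|apply: is_RInt_gen_scal];
    now apply cosh_moment_correct.
  - apply: is_RInt_gen_scal; apply cosh_moment_correct; lra.
apply is_derive_ext with (fun y => v y + (cosh_moment p x - (y - x) * cosh_moment (S p) x)).
  intros y; unfold v; Rring.
evar_last.
  apply: is_derive_plus; [apply Hv|].
  instantiate (1 := - cosh_moment (S p) x); auto_derive; auto; ring.
unfold plus; simpl; ring.
Qed.

(** The derivative of sinh t e^(-x cosh t) is the integrand of the difference
    of both sides, by sinh^2 = cosh^2 - 1, and this function vanishes at 0 and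
    at infinity. *)
Lemma cosh_moment_parts x :
  0 < x -> cosh_moment 1 x = x * (cosh_moment 2 x - cosh_moment 0 x).
Proof.
intros Hx.
set (h := fun t => sinh t * exp (- x * cosh t)).
assert (Hd : forall t, is_derive h t
  (cosh_kernel 1 x t - x * (cosh_kernel 2 x t - cosh_kernel 0 x t))).
  intros t; unfold h, cosh_kernel.
  assert (Hs : is_derive sinh t (cosh t)) by apply is_derive_Reals, derivable_pt_lim_sinh.
  assert (Hc := cosh_derive t).
  evar_last.
    apply: is_derive_mult; [apply Hs| |intros; apply Rmult_comm].
    apply (is_derive_comp exp (fun t => - x * cosh t)).
      apply is_derive_Reals, derivable_pt_lim_exp.
    apply: is_derive_scal; apply Hc.
  unfold plus, mult, scal; simpl; unfold mult; simpl.
  assert (E : sinh t * sinh t = cosh t * cosh t - 1).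
    unfold sinh, cosh.
    assert (exp t * exp (- t) = 1).
      rewrite -exp_plus; replace (t + - t) with 0 by ring; apply exp_0.
    lra.
  transitivity (exp (- x * cosh t) * cosh t - x * (sinh t * sinh t) * exp (- x * cosh t)).
    ring.
  rewrite E; ring.
assert (Hlim : filterlim h (Rbar_locally p_infty) (locally 0)).
  change (is_lim h p_infty 0).
  apply is_lim_le_le_loc with (fun t => - (2 * INR (fact 2) / x ^ 2 * exp (- t)))
    (fun t => 2 * INR (fact 2) / x ^ 2 * exp (- t)).
  - exists 0; intros t Ht.
    assert (P := cosh_kernel_le 1 x t Hx).
    assert (Q : Rabs (h t) <= cosh_kernel 1 x t).
      unfold h, cosh_kernel; rewrite Rabs_mult (Rabs_pos_eq (exp _)); [|left; apply exp_pos].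
      apply Rmult_le_compat_r; [left; apply exp_pos|].
      rewrite pow_1; unfold sinh, cosh.
      assert (Q1 := exp_pos t); assert (Q2 := exp_pos (- t)).
      apply Rabs_le; lra.
    apply Rabs_le_between; lra.
  - replace (Finite 0) with (Rbar_opp (Rbar_mult (2 * INR (fact 2) / x ^ 2) 0))
      by (simpl; f_equal; ring).
    apply is_lim_opp, is_lim_scal_l.
    apply is_lim_comp with m_infty; [apply is_lim_exp_m| |].
      apply (is_lim_opp (fun t => t) p_infty p_infty), is_lim_id.
    now exists 0.
  - replace (Finite 0) with (Rbar_mult (2 * INR (fact 2) / x ^ 2) 0)
      by (simpl; f_equal; ring).
    apply is_lim_scal_l.
    apply is_lim_comp with m_infty; [apply is_lim_exp_m| |].
      apply (is_lim_opp (fun t => t) p_infty p_infty), is_lim_id.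
    now exists 0.
assert (H0 : is_RInt_gen (Derive h) (at_point 0) (Rbar_locally p_infty) (0 - 0)).
  apply is_RInt_gen_Derive; auto.
  - apply at_point_0_infty_le; intros b _ t _; eexists; apply Hd.
  - apply at_point_0_infty_le; intros b _ t _.
    apply (continuous_ext (fun t => cosh_kernel 1 x t - x * (cosh_kernel 2 x t - cosh_kernel 0 x t))).
      intros y; symmetry; apply is_derive_unique, Hd.
    apply: continuous_minus; [apply cosh_kernel_continuous|].
    apply: continuous_scal_r; apply: continuous_minus; apply cosh_kernel_continuous.
  - intros P HP; unfold filtermap, at_point.
    replace (h 0) with 0; [now apply locally_singleton|].
    unfold h; rewrite sinh_0; ring.
assert (H1 : is_RInt_gen (Derive h) (at_point 0) (Rbar_locally p_infty)
  (cosh_moment 1 x - x * (cosh_moment 2 x - cosh_moment 0 x))).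
  apply is_RInt_gen_ext with
    (fun t => cosh_kernel 1 x t - x * (cosh_kernel 2 x t - cosh_kernel 0 x t)).
    apply at_point_0_infty_le; intros b _ t _; symmetry; apply is_derive_unique, Hd.
  apply: is_RInt_gen_minus; [now apply cosh_moment_correct|].
  apply: is_RInt_gen_scal; apply: is_RInt_gen_minus; now apply cosh_moment_correct.
assert (E := eq_trans (eq_sym (is_RInt_gen_unique _ _ H0)) (is_RInt_gen_unique _ _ H1)).
simpl in E; lra.
Qed.

Lemma besselK_0 x : 0 < x -> besselK 0 x = cosh_moment 0 x.
Proof.
intros Hx; unfold besselK.
apply (is_RInt_gen_unique (Fa := at_point 0) (Fb := Rbar_locally p_infty)).
apply is_RInt_gen_ext with (cosh_kernel 0 x); [|now apply cosh_moment_correct].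
apply at_point_0_infty_le; intros b _ t _; unfold cosh_kernel; simpl.
rewrite Rmult_0_l cosh_0; ring.
Qed.

Lemma besselK_1 x : 0 < x -> besselK 1 x = cosh_moment 1 x.
Proof.
intros Hx; unfold besselK.
apply (is_RInt_gen_unique (Fa := at_point 0) (Fb := Rbar_locally p_infty)).
apply is_RInt_gen_ext with (cosh_kernel 1 x); [|now apply cosh_moment_correct].
apply at_point_0_infty_le; intros b _ t _; unfold cosh_kernel; simpl.
rewrite Rmult_1_l; ring.
Qed.

Lemma besselK_carrier : carrier_system 2 (fun x => 0 < x) besselK_system.
Proof.
apply (carrier_of_real 2 (fun r x => match r with O => besselK 0 x | S _ => - besselK 1 x end)).
intros r x Hr Hx.
assert (Hloc : locally x (fun y => 0 < y)) by (apply (open_gt 0); auto).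
assert (D0 : is_derive (besselK 0) x (- cosh_moment 1 x)).
  apply is_derive_ext_loc with (cosh_moment 0); [|now apply cosh_moment_derive].
  generalize Hloc; apply: filter_imp => y Hy; symmetry; now apply besselK_0.
assert (D1 : is_derive (besselK 1) x (- cosh_moment 2 x)).
  apply is_derive_ext_loc with (cosh_moment 1); [|now apply cosh_moment_derive].
  generalize Hloc; apply: filter_imp => y Hy; symmetry; now apply besselK_1.
destruct r as [|[|r]]; [| |lia].
- exists (- cosh_moment 1 x); split; auto.
  simpl; rewrite besselK_1 //; ring.
- exists (cosh_moment 2 x); split.
    rewrite -(Ropp_involutive (cosh_moment 2 x)); now apply: is_derive_opp.
  simpl; rewrite besselK_0 // besselK_1 //.
  assert (P := cosh_moment_parts x Hx); lra.
Qed.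

(** * The hyper-Bessel functions, I_0 and I_1 *)

Definition hyper_coef (m r k : nat) : R :=
  / (INR (fact k) ^ r * INR (fact (k + 1)) ^ (m - r)).

(** The function C_r for 1 <= r <= m, where r = m encodes C_0. With this
    indexing all carrier equations but the last are the single recurrence
    [hyper_coef_S]. *)
Definition hyper_form (m r : nat) (x : R) : R :=
  (x / INR m) ^ (m - r) * PSeries (hyper_coef m r) ((x / INR m) ^ m).

Lemma hyperBessel_form m r x :
  (1 <= r <= m)%nat -> hyperBessel m (r mod m) x = hyper_form m r x.
Proof.
intros Hr; unfold hyper_form, PSeries.
rewrite -Series_scal_l.
destruct (Nat.eq_dec r m) as [->|Hn].
- rewrite Nat.Div0.mod_same; apply Series_ext; intros k; unfold hyper_coef.
  rewrite Nat.sub_diag !pow_mult; simpl; unfold Rdiv; rewrite !Rmult_1_r; ring.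
- rewrite Nat.mod_small; [|lia]; destruct r as [|r]; [lia|].
  apply Series_ext; intros k; unfold hyper_coef.
  replace (m * k + m - S r)%nat with ((m - S r) + m * k)%nat by lia.
  rewrite pow_add (pow_mult _ m k); unfold Rdiv; ring.
Qed.

Lemma one_le_INR_fact k : 1 <= INR (fact k).
Proof. apply (le_INR 1), lt_O_fact. Qed.

Lemma hyper_coef_le m r k :
  (1 <= r)%nat -> 0 < hyper_coef m r k <= / INR (fact k).
Proof.
intros Hr; unfold hyper_coef.
assert (H1 := one_le_INR_fact k); assert (H2 := one_le_INR_fact (k + 1)).
assert (H3 : 1 <= INR (fact (k + 1)) ^ (m - r)) by now apply pow_R1_Rle.
assert (H4 : INR (fact k) <= INR (fact k) ^ r).
  rewrite -{1}(pow_1 (INR (fact k))); now apply Rle_pow.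
split.
- apply Rinv_0_lt_compat, Rmult_lt_0_compat; lra.
- apply Rinv_le_contravar; [lra|]; nra.
Qed.

(** The coefficients are at most 1/k!, hence the series is entire. *)
Lemma hyper_coef_radius m r x :
  (1 <= r)%nat -> Rbar_lt (Rabs x) (CV_radius (hyper_coef m r)).
Proof.
intros Hr; apply Rbar_lt_le_trans with (Rabs x + 1); [simpl; lra|].
destruct (CV_radius_bounded (hyper_coef m r)) as [Hub _]; apply Hub.
assert (Hx := Rabs_pos x).
exists (exp (Rabs x + 1)); intros n.
destruct (hyper_coef_le m r n Hr) as [H1 H2].
assert (Hp : 0 <= (Rabs x + 1) ^ n) by (apply pow_le; lra).
rewrite Rabs_pos_eq; [|apply Rmult_le_pos; lra].
eapply Rle_trans; [|apply (pow_div_fact_le_exp _ n); lra].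
unfold Rdiv; rewrite Rmult_comm; apply Rmult_le_compat_l; auto.
Qed.

Lemma hyper_coef_S m r k :
  (r < m)%nat -> INR (S k) * hyper_coef m r k = hyper_coef m (S r) k.
Proof.
intros Hr; unfold hyper_coef.
assert (H1 := INR_fact_neq_0 k); assert (H2 := INR_fact_neq_0 (k + 1)).
assert (HS : INR (S k) <> 0) by now apply not_0_INR.
replace (m - r)%nat with (S (m - S r)) by lia.
simpl pow.
assert (E : INR (fact (k + 1)) = INR (S k) * INR (fact k)).
  rewrite Nat.add_1_r fact_simpl mult_INR //.
rewrite {1}E; field; repeat split; auto; apply pow_nonzero; auto.
Qed.

Lemma hyper_coef_m m k :
  (1 <= m)%nat -> INR (S k) * hyper_coef m m (S k) = hyper_coef m 1 k.
Proof.
intros Hm; unfold hyper_coef.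
assert (H1 := INR_fact_neq_0 k); assert (H2 := INR_fact_neq_0 (k + 1)).
assert (HS : INR (S k) <> 0) by now apply not_0_INR.
rewrite Nat.sub_diag pow_O Rmult_1_r pow_1.
replace (S k) with (k + 1)%nat by lia.
destruct m as [|m]; [lia|].
replace (S m - 1)%nat with m by lia; simpl pow.
assert (E : INR (fact (k + 1)) = INR (k + 1) * INR (fact k)).
  rewrite Nat.add_1_r fact_simpl mult_INR //.
rewrite {1}E; field; repeat split; auto; try apply pow_nonzero; auto.
rewrite Nat.add_1_r; auto.
Qed.

Lemma hyper_form_derive m r x :
  (1 <= r <= m)%nat -> 0 < x ->
  exists l, is_derive (hyper_form m r) x l /\
    x * l = INR (m - r) * hyper_form m r x +
      INR m * (x / INR m) ^ (m - r) * (x / INR m) ^ m *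
      PSeries (PS_derive (hyper_coef m r)) ((x / INR m) ^ m).
Proof.
intros Hr Hx.
assert (Hm : INR m <> 0) by (apply not_0_INR; lia).
assert (Hp : forall n, is_derive (fun x => (x / INR m) ^ n) x (INR n * (x / INR m) ^ n / x)).
  intros n; auto_derive; auto.
  destruct n; [simpl; field; lra|]; simpl Init.Nat.pred; simpl pow; unfold Rdiv; field; lra.
eexists; split.
  apply: is_derive_mult; [apply Hp| |intros; apply Rmult_comm].
  apply (is_derive_comp (PSeries (hyper_coef m r)) (fun x => (x / INR m) ^ m)).
    apply is_derive_PSeries, hyper_coef_radius; lia.
  apply Hp.
unfold hyper_form, plus, mult, scal; simpl; unfold mult; simpl; field; lra.
Qed.

Lemma hyper_form_step m r x :
  (1 <= r < m)%nat -> 0 < x ->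
  exists l, is_derive (hyper_form m r) x l /\
    x * l + INR r * hyper_form m r x = x * hyper_form m (S r) x.
Proof.
intros Hr Hx; destruct (hyper_form_derive m r x) as [l [Hl E]]; [lia|auto|].
exists l; split; auto.
assert (Hm : INR m <> 0) by (apply not_0_INR; lia).
rewrite E minus_INR; [|lia]; unfold hyper_form.
set (z := (x / INR m) ^ m).
assert (Hs : PSeries (hyper_coef m (S r)) z =
  PSeries (hyper_coef m r) z + z * PSeries (PS_derive (hyper_coef m r)) z).
  rewrite -PSeries_incr_1 -PSeries_plus.
  - apply PSeries_ext; intros k; rewrite -hyper_coef_S; [|lia].
    unfold PS_plus, PS_incr_1, PS_derive, plus, zero; destruct k; simpl; [ring|].
    destruct k; simpl; ring.
  - apply CV_radius_inside, hyper_coef_radius; lia.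
  - apply ex_pseries_incr_1, CV_radius_inside; rewrite CV_radius_derive.
    apply hyper_coef_radius; lia.
rewrite Hs; replace (m - r)%nat with (S (m - S r)) by lia; simpl pow.
field; auto.
Qed.

(** The equation that closes the cycle: the derivative of the power series of
    C_0 is the power series of C_1. *)
Lemma hyper_form_wrap m x :
  (1 <= m)%nat -> 0 < x ->
  exists l, is_derive (hyper_form m m) x l /\ x * l = x * hyper_form m 1 x.
Proof.
intros Hm Hx; destruct (hyper_form_derive m m x) as [l [Hl E]]; [lia|auto|].
exists l; split; auto.
assert (Hm0 : INR m <> 0) by (apply not_0_INR; lia).
rewrite E Nat.sub_diag; unfold hyper_form.
rewrite (PSeries_ext (PS_derive (hyper_coef m m)) (hyper_coef m 1)).
  assert (Ez : (x / INR m) ^ m = x / INR m * (x / INR m) ^ (m - 1)).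
    replace m with (S (m - 1)) at 2 by lia; reflexivity.
  change (INR 0) with 0; rewrite Rmult_0_l pow_O.
  set (P := PSeries _ _); rewrite Ez; field; auto.
intros k; unfold PS_derive; now apply hyper_coef_m.
Qed.

Lemma hyperBessel_carrier m :
  (1 <= m)%nat -> carrier_system m (fun x => 0 < x) (hyperBessel_system m).
Proof.
intros Hm; apply (carrier_of_real m (hyperBessel m)).
intros r x Hr Hx.
assert (T : forall q l, (1 <= q <= m)%nat -> is_derive (hyper_form m q) x l ->
  is_derive (hyperBessel m (q mod m)) x l).
  intros q l Hq Hl; apply is_derive_ext with (2 := Hl).
  intros y; symmetry; now apply hyperBessel_form.
destruct r as [|r].
- destruct (hyper_form_wrap m x Hm Hx) as [l [Hl E]]; exists l; split.
    rewrite -(Nat.Div0.mod_same m); apply T; auto.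
  rewrite E -(hyperBessel_form m 1); [|lia]; simpl; ring.
- destruct (hyper_form_step m (S r) x) as [l [Hl E]]; [lia|auto|]; exists l; split.
    rewrite -(Nat.mod_small (S r) m) //; apply T; auto; lia.
  assert (E1 : hyperBessel m (S r) x = hyper_form m (S r) x).
    rewrite -(hyperBessel_form m (S r)); [|lia]; now rewrite Nat.mod_small.
  rewrite E1 E Nat.add_1_r -(hyperBessel_form m (S (S r))) //; lia.
Qed.

Lemma carrier_ext m U f g :
  (1 <= m)%nat -> (forall r x, (r < m)%nat -> f r x = g r x) ->
  carrier_system m U f -> carrier_system m U g.
Proof.
intros Hm E [HU [Hp H]]; split; auto; split; auto.
intros r Hr x Hx; destruct (H r Hr x Hx) as [Hd Hf]; split.
  apply: ex_derive_ext Hd => y; now apply E.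
rewrite -!E //; [|now apply Nat.mod_upper_bound; lia].
rewrite -Hf /xD /CDerive; do 3 f_equal; apply Derive_ext => y; now rewrite E.
Qed.

Lemma besselI_carrier : carrier_system 2 (fun x => 0 < x) besselI_system.
Proof.
apply (carrier_ext 2 _ (hyperBessel_system 2)); [lia| |apply hyperBessel_carrier; lia].
intros r x Hr; unfold besselI_system, hyperBessel_system; f_equal.
destruct r as [|[|r]]; [| |lia]; unfold besselI, hyperBessel; apply Series_ext; intros k.
- rewrite !Nat.add_0_r; simpl; rewrite !Rmult_1_r //.
- replace (2 * k + 2 - 1)%nat with (2 * k + 1)%nat by lia.
  simpl; rewrite !Rmult_1_r //.
Qed.

(** * Formal power series *)

Module FormalSeries.
Import all_boot all_algebra GRing.Theory.
Local Open Scope ring_scope.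

Lemma xD_coef (K : nzRingType) (a : nat -> K) j : FPS.xD a j = a j *+ j.
Proof. by case: j => [|j]; rewrite /FPS.xD /FPS.mulXn // subn1. Qed.

(** The ladder step for x^k f_{k mod m}, read off at the coefficient of x^j.
    The rest follows by comparing it with the recurrence of the Stirling
    numbers. *)
Lemma carrier_monomial_xD (K : nzRingType) m (a : nat -> nat -> K) k j :
  (0 < m)%N -> FPS.carrier_system m a ->
  FPS.mulXn k (a (Nat.modulo k m)) j *+ j =
  FPS.mulXn k (a (Nat.modulo k m)) j *+ Nat.mul m (Nat.div k m)
  + FPS.mulXn k.+1 (a (Nat.modulo k.+1 m)) j.
Proof.
move=> m_gt0 Ha; rewrite /FPS.mulXn.
case: (ltnP j k) => [ltjk|lekj]; first by rewrite ltnS (ltnW ltjk) !mul0rn addr0.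
rewrite -(subnK lekj); move: (j - k)%N => i.
have ltr : (Nat.modulo k m < m)%N.
  by apply/ltP; apply: Nat.mod_upper_bound; apply/eqP; rewrite -lt0n.
have := Ha _ ltr i.
rewrite xD_coef -plusE Nat.Div0.add_mod_idemp_l Nat.add_1_r /FPS.mulXn => E.
have Ek : (k = Nat.mul m (Nat.div k m) + Nat.modulo k m)%N by apply: Nat.div_mod_eq.
rewrite plusE addnK {2}Ek mulrnDr [in X in X = _]mulrnDr.
have -> : ((i + k < k.+1) = (i < 1))%N by rewrite !ltnS -[X in (_ <= X)%N](add0n k) leq_add2r.
have -> : (i + k - k.+1 = i - 1)%N by rewrite -[k.+1]add1n subnDr.
by rewrite -E addrC -addrA [_ *+ i + _]addrC.
Qed.

Lemma iter_xD_stirling_sum (K : nzRingType) m (a : nat -> nat -> K) n j :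
  (0 < m)%N -> FPS.carrier_system m a ->
  Nat.iter n FPS.xD (a 0%N) j = FPS.stirling_sum m a n j.
Proof.
move=> m_gt0 Ha; elim: n j => [|n IH] j.
  rewrite /FPS.stirling_sum big_nat1 /= Nat.Div0.mod_0_l mulr1n.
  by rewrite /FPS.mulXn subn0.
rewrite [LHS](xD_coef _ (Nat.iter n FPS.xD (a 0%N)) j) IH /FPS.stirling_sum -sumrMnl.
pose F k := FPS.mulXn k (a (Nat.modulo k m)) j.
pose e k := Nat.mul m (Nat.div k m).
have step k : F k *+ mStirling2 m n k *+ j =
    F k *+ (e k * mStirling2 m n k) + F k.+1 *+ mStirling2 m n k.
  by rewrite -mulrnA mulnC mulrnA carrier_monomial_xD // mulrnDl -mulrnA.
rewrite (eq_bigr _ (fun k _ => step k)) big_split /=.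
have last0 : mStirling2 m n n.+1 = 0%N.
  by rewrite (mStirling2_gt m n n.+1) //; apply/ltP.
have -> : \sum_(0 <= k < n.+1) F k *+ (e k * mStirling2 m n k) =
          \sum_(0 <= k < n.+2) F k *+ (e k * mStirling2 m n k).
  by rewrite [RHS]big_nat_recr //= last0 muln0 mulr0n addr0.
rewrite !(@big_nat_recl _ _ _ n.+1) //= -addrA -big_split /=.
congr (_ + _); first by rewrite plusE addn0.
by apply: eq_bigr => k _; rewrite plusE mulrnDr.
Qed.
End FormalSeries.

(** * The expansion theorem *)

Theorem theorem7p7 :
  (* arbitrary carrier systems of functions *)
  (forall (m : nat) (U : R -> Prop) (f : nat -> R -> C),
     (1 <= m)%nat -> carrier_system m U f ->
     (* the finite identity; the iterates of xD are genuine derivatives *)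
     (forall (n : nat) (x : R), U x ->
        differentiable (Nat.iter n xD (f 0%nat)) x /\
        Nat.iter n xD (f 0%nat) x = stirling_sum m f n x)
     /\
     (* the expansion as an identity of formal power series in t *)
     (forall x : R, U x ->
        forall n : nat, exp_txD (f 0%nat) x n = stirling_series m f x n)
     /\
     (* the analytic expansion, real t *)
     (forall (x t : R) (W : R -> Prop), U x -> open W ->
        (forall s : R, Rabs s <= Rabs t -> W (x * exp s)) ->
        (forall y : R, W y -> analytic_at (f 0%nat) y) ->
        forall s : R, Rabs s <= Rabs t ->
          is_Cpseries (stirling_series m f x) (RtoC s) (f 0%nat (x * exp s)))
     /\
     (* the analytic expansion, complex t, for an analytic extension g of f_0 *)
     (forall (x : R) (t : C) (W : C -> Prop) (g : C -> C), U x -> open W ->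
        (forall s : C, Cmod s <= Cmod t -> W (RtoC x * Cexp s)%C) ->
        (forall z : C, W z -> Canalytic_at g z) ->
        locally x (fun y : R => g (RtoC y) = f 0%nat y) ->
        forall s : C, Cmod s <= Cmod t ->
          is_Cpseries (stirling_series m f x) s (g (RtoC x * Cexp s)%C)))
  /\
  (* carrier systems of formal power series: the finite identity *)
  (forall (K : comNzRingType) (m : nat) (a : nat -> nat -> K),
     (1 <= m)%nat -> FPS.carrier_system m a ->
     forall n j : nat,
       Nat.iter n FPS.xD (a 0%nat) j = FPS.stirling_sum m a n j)
  /\
  (* carrier systems of formal power series: the expansion in t *)
  (forall (K : fieldType) (m : nat) (a : nat -> nat -> K),
     FPS.char_zero K -> (1 <= m)%nat -> FPS.carrier_system m a ->
     forall n j : nat,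
       FPS.exp_txD (a 0%nat) n j = FPS.stirling_series m a n j)
  /\
  (* the Bessel and hyper-Bessel systems *)
  (forall (m : nat) (f : nat -> R -> C), bessel_type m f ->
     carrier_system m (fun x => 0 < x) f /\
     (forall r : nat, (r < m)%nat -> forall x : R, 0 < x -> analytic_at (f r) x) /\
     (forall x t : R, 0 < x ->
        is_Cpseries (stirling_series m f x) (RtoC t) (f 0%nat (x * exp t)))).
Proof.
split; [|split; [|split]].
- intros m U f Hm Hf; split; [|split; [|split]].
  + intros n x Hx; split.
      now apply (iter_xD_differentiable m U).
    now apply (iter_xD_stirling_sum m U).
  + intros x Hx n; unfold exp_txD, stirling_series.
    now rewrite (iter_xD_stirling_sum m U).
  + intros x t W Hx _; now apply (analytic_expansion_real m U).
  + intros x t W g Hx _; now apply (analytic_expansion_complex m U).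
- intros K m a Hm Ha n j.
  apply: (FormalSeries.iter_xD_stirling_sum _ m a n j) Ha; now destruct m; [inversion Hm|].
- intros K m a _ Hm Ha n j; unfold FPS.exp_txD, FPS.stirling_series.
  rewrite (FormalSeries.iter_xD_stirling_sum _ m) //; now destruct m; [inversion Hm|].
- assert (H : forall m f, (1 <= m)%nat -> carrier_system m (fun x => 0 < x) f ->
    carrier_system m (fun x => 0 < x) f /\
    (forall r : nat, (r < m)%nat -> forall x : R, 0 < x -> analytic_at (f r) x) /\
    (forall x t : R, 0 < x ->
      is_Cpseries (stirling_series m f x) (RtoC t) (f 0%nat (x * exp t)))).
    intros m f Hm Hf; split; [|split]; auto.
    + intros r Hr x Hx; now apply (carrier_analytic m (fun x => 0 < x)).
    + intros x t Hx; now apply stirling_expansion.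
  intros m f [| |m' Hm']; apply H; auto.
  + apply besselI_carrier.
  + apply besselK_carrier.
  + now apply hyperBessel_carrier.
Qed.
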